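(* Let $A$ be a finitely presented connected graded algebra over a field $k$, and let $\mathbf{F}$ be a quasi-coherent family of ideals of degree $d$ in $A$. (i) For every ideal $I\in\mathbf{F}$ there are two polynomials $p(z),q(z)$ with integer coefficients such that $I(z)=A(z)\dfrac{p(z)}{q(z)}$. (ii) Assume that $d=1$, i.e. $\mathbf{F}$ is a Koszul family. Then for every ideal $I\in\mathbf{F}$ its Poincaré series $P_I(z)=\sum_{i\ge0}\bigl(\dim_k\mathrm{Tor}_i^A(I,k)\bigr)z^i$ is a rational function.
   Context: A connected graded algebra over $k$ is an associative algebra $A=\bigoplus_{i\ge 0}A_i$ with $A_0=k$; it is finitely presented if it has finitely many generators and finitely many relations. For a graded right module $M$, $m_0(M)$ is the supremum of the degrees of minimal homogeneous generators of $M$, i.e. $m_0(M)=\sup\{j\mid \mathrm{Tor}_0^A(M,k)_j\ne0\}$ (and $0$ if $M=0$). $[-t]$ denotes the degree shift $(V[-t])_j=V_{j-t}$. A set $\mathbf{F}$ of finitely generated homogeneous right ideals of $A$ is a quasi-coherent family of ideals if $0\in\mathbf{F}$ and for every $0\ne I\in\mathbf{F}$ there are $J_1,J_2\in\mathbf{F}$ such that $J_1\subset I$, $J_1\ne I$, $m_0(J_1)\le m_0(I)$, and $I/J_1\cong (A/J_2)[-t]$ as graded right modules for some integer $t\ge0$. It is of degree $d$ if $m_0(I)\le d$ for all $I\in\mathbf{F}$. A quasi-coherent family of degree $1$ is called a Koszul family. The Hilbert series of a locally finite graded vector space $V$ is $V(z)=\sum_i(\dim_k V_i)z^i$. *)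

(* Defs.v *)
From HB Require Import structures.
From mathcomp Require Import all_boot all_order all_algebra.
From mathcomp Require Import monalg.
From mathcomp Require Import boolp classical_sets.

Set Implicit Arguments.
Unset Strict Implicit.
Unset Printing Implicit Defensive.

Import GRing.Theory.

Local Open Scope classical_set_scope.
Local Open Scope ring_scope.

(* dim_k (Z / B) = n, for subspaces B and Z of V. Uniqueness of the
   coordinates, applied to z = 0, is linear independence modulo B. *)
Definition quotient_dim (k : fieldType) (V : lmodType k) (Z B : set V)
    (n : nat) : Prop :=
  exists v : 'I_n -> V, (forall i, Z (v i)) /\
    forall z, Z z -> exists! c : 'rV[k]_n, B (z - \sum_(i < n) c 0 i *: v i).

(* h is the sequence of coefficients of the Hilbert series of S, a
   homogeneous subspace of V with respect to the grading gr of V. *)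
Definition hilbert_series (k : fieldType) (V : lmodType k)
    (gr : nat -> set V) (S : set V) (h : nat -> nat) : Prop :=
  forall j, quotient_dim (S `&` gr j) [set 0] (h j).

(* The coefficients of p(z) h(z), where h(z) = \sum_i h_i z^i. *)
Definition poly_mul_series (p : {poly int}) (h : nat -> nat) (n : nat) : int :=
  \sum_(i < n.+1) p`_i * (h (n - i)%N)%:Z.

Definition rational_series (h : nat -> nat) : Prop :=
  exists p q : {poly int},
    q != 0 /\ forall n, poly_mul_series q h n = p`_n.

(* Since A is a nonzero ring, A_0 = k%:A says that A_0 is a copy of k. *)
Record connected_grading (k : fieldType) (A : algType k)
    (gr : nat -> set A) : Prop := ConnectedGrading {
  gr_zero : forall i, gr i 0;
  gr_linear : forall i (c : k) x y, gr i x -> gr i y -> gr i (c *: x + y);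
  gr_mul : forall i j x y, gr i x -> gr j y -> gr (i + j)%N (x * y);
  gr_span : forall x, exists n (a : nat -> A),
    (forall i, gr i (a i)) /\ x = \sum_(i < n) a i;
  gr_direct : forall n (a : nat -> A), (forall i, gr i (a i)) ->
    \sum_(i < n) a i = 0 -> forall i, (i < n)%N -> a i = 0;
  gr_connected : gr 0%N = [set x | exists c : k, x = c%:A]
}.

(* The free associative algebra k<x_0, ..., x_(n-1)>. *)
Definition free_algebra (k : fieldType) (n : nat) : lalgType k :=
  {malg k[{fmonom 'I_n}]}.

Definition two_sided_ideal_gen (R : nzRingType) (rels : seq R) : set R :=
  [set f | exists s : seq (R * R * R),
     (forall u, u \in s -> u.1.2 \in rels) /\
     f = \sum_(u <- s) u.1.1 * u.1.2 * u.2].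

Definition finitely_presented (k : fieldType) (A : algType k) : Prop :=
  exists n (phi : {lrmorphism free_algebra k n -> A})
    (rels : seq (free_algebra k n)),
    (forall a, exists f, phi f = a) /\
    forall f, phi f = 0 <-> two_sided_ideal_gen rels f.

(* Right A-modules are left modules over the converse ring A^c: x.a is
   written a *: x. In particular A^c^o is A as a right module over itself. *)
Definition restrict_scalars (k : fieldType) (A : algType k)
  (M : lmodType A^c) : Type := M.

Section RestrictScalars.
Variables (k : fieldType) (A : algType k) (M : lmodType A^c).

HB.instance Definition _ :=
  GRing.Zmodule.copy (restrict_scalars M) M.

Definition restr_scale (c : k) (x : restrict_scalars M) : restrict_scalars M :=
  (c%:A : A^c) *: (x : M).

Fact restr_scaleA c d x :
  restr_scale c (restr_scale d x) = restr_scale (c * d) x.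
Proof.
rewrite /restr_scale scalerA; congr (_ *: _).
by rewrite -[LHS]/((d%:A : A) * c%:A) mulr_algr scalerA.
Qed.

Fact restr_scale1 : left_id 1 restr_scale.
Proof. by move=> x; rewrite /restr_scale scale1r scale1r. Qed.

Fact restr_scaleDr : right_distributive restr_scale +%R.
Proof. by move=> c x y; rewrite /restr_scale scalerDr. Qed.

Fact restr_scaleDl x : {morph restr_scale^~ x : c d / c + d}.
Proof. by move=> c d; rewrite /restr_scale scalerDl scalerDl. Qed.

HB.instance Definition _ := GRing.Zmodule_isLmodule.Build k
  (restrict_scalars M) restr_scaleA restr_scale1 restr_scaleDr restr_scaleDl.
End RestrictScalars.

Section GradedAlgebra.
Variables (k : fieldType) (A : algType k) (gr : nat -> set A).

Definition right_ideal (I : set A) : Prop :=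
  [/\ I 0, forall x y, I x -> I y -> I (x + y) & forall x a, I x -> I (x * a)].

Definition homogeneous (I : set A) : Prop :=
  forall x, I x -> exists n (a : nat -> A),
    (forall i, I (a i) /\ gr i (a i)) /\ x = \sum_(i < n) a i.

Definition finitely_generated (I : set A) : Prop :=
  exists n (g : 'I_n -> A),
    I = [set x | exists a : 'I_n -> A, x = \sum_(i < n) g i * a i].

Definition augmentation_ideal : set A :=
  [set x | exists n (a : nat -> A),
     (forall i, gr i.+1 (a i)) /\ x = \sum_(i < n) a i].

(* The submodule S A_+ of M. As k = A / A_+, one has
   S (x)_A k = S / S A_+ for every submodule S of M. *)
Definition mul_augmentation (M : lmodType A^c) (S : set M) : set M :=
  [set x | exists n (s : 'I_n -> M) (a : 'I_n -> A),
     (forall i, S (s i) /\ augmentation_ideal (a i)) /\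
     x = \sum_(i < n) (a i : A^c) *: s i].

(* Tor_0(I, k)_j = (I / I A_+)_j. The supremum of the empty set is taken to
   be 0, and the set below is bounded as soon as I is finitely generated. *)
Definition m0 (I : set A) : nat :=
  supremum 0%N [set j | exists x, [/\ I x, gr j x &
                                   ~ mul_augmentation (M := A^c^o) I x]].

(* The grading of the shifted module V[-t]. *)
Definition shift_grading (V : zmodType) (g : nat -> set V) (t j : nat) :
    set V :=
  if (t <= j)%N then g (j - t)%N else [set 0].

(* S / T and S' / T' are isomorphic as graded right modules, where T `<=` S and
   T' `<=` S' are homogeneous right ideals, A is graded by g in the source and
   by g' in the target. The isomorphism is given by a map f on representatives:
   it is well defined and additive, A-linear, injective, surjective, and it
   preserves degrees. *)
Definition graded_quotient_iso (g : nat -> set A) (S T : set A)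
    (g' : nat -> set A) (S' T' : set A) : Prop :=
  exists f : A -> A,
    [/\ forall x, S x -> S' (f x),
        forall x y, S x -> S y -> T' (f (x + y) - (f x + f y)),
        forall x a, S x -> T' (f (x * a) - f x * a) &
        [/\ forall x, S x -> (T x <-> T' (f x)),
            forall y, S' y -> exists2 x, S x & T' (y - f x) &
            forall j x, S x -> g j x ->
              exists y, [/\ S' y, g' j y & T' (f x - y)]]].

Definition quasi_coherent_family (F : set (set A)) : Prop :=
  [/\ forall I, F I ->
        [/\ right_ideal I, homogeneous I & finitely_generated I],
      F [set 0] &
      forall I, F I -> I <> [set 0] -> exists J1 J2 : set A,
        [/\ F J1, F J2, J1 `<=` I /\ J1 <> I, (m0 J1 <= m0 I)%N &
            exists t : nat, graded_quotient_iso gr I J1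
                              (shift_grading gr t) setT J2]].

(* A Koszul family is a quasi-coherent family of degree 1. *)
Definition family_of_degree (F : set (set A)) (d : nat) : Prop :=
  forall I, F I -> (m0 I <= d)%N.

Definition free_module (M : lmodType A^c) : Prop :=
  exists B : set M,
    (forall x, exists n (b : 'I_n -> M) (a : 'I_n -> A^c),
       (forall i, B (b i)) /\ x = \sum_(i < n) a i *: b i) /\
    (forall n (b : 'I_n -> M) (a : 'I_n -> A^c), injective b ->
       (forall i, B (b i)) -> \sum_(i < n) a i *: b i = 0 ->
       forall i, a i = 0).

(* ... -> P 1 -> P 0 -> S -> 0 is exact, with P i free and S a submodule of M *)
Definition free_resolution (M : lmodType A^c) (S : set M)
    (P : nat -> lmodType A^c) (eps : {linear P 0%N -> M})
    (del : forall i, {linear P i.+1 -> P i}) : Prop :=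
  [/\ forall i, free_module (P i),
      range eps = S,
      eps @^-1` [set 0] = range (del 0%N) &
      forall i, del i @^-1` [set 0] = range (del i.+1)].

Section TensorComplex.
Variables (P : nat -> lmodType A^c) (del : forall i, {linear P i.+1 -> P i}).

(* Cycles and boundaries of the complex P (x)_A k = P / P A_+, both as
   subspaces of P i containing (P i) A_+. *)
Definition tensor_cycles (i : nat) : set (P i) :=
  match i with
  | 0 => setT
  | j.+1 => [set x | mul_augmentation setT (del j x)]
  end.

Definition tensor_boundaries (i : nat) : set (P i) :=
  [set x | exists y : P i.+1, mul_augmentation setT (x - del i y)].
End TensorComplex.

(* dim_k Tor_i^A(S, k) = n, for a submodule S of a right A-module M: Tor is
   computed from a free resolution of S, the dimension being independent of
   the resolution. *)
Definition Tor_dim (M : lmodType A^c) (S : set M) (i n : nat) : Prop :=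
  exists (P : nat -> lmodType A^c) (eps : {linear P 0%N -> M})
    (del : forall i, {linear P i.+1 -> P i}),
    free_resolution S eps del /\
    quotient_dim (V := restrict_scalars (P i))
      (@tensor_cycles P del i) (@tensor_boundaries P del i) n.

Definition Poincare_series (I : set A) (b : nat -> nat) : Prop :=
  forall i, Tor_dim (M := A^c^o) I i (b i).

End GradedAlgebra.

(* Main.v *)
Require Import Defs.
From HB Require Import structures.
From mathcomp Require Import all_boot all_order all_algebra.
From mathcomp Require Import monalg.
From mathcomp Require Import boolp classical_sets.
From mathcomp Require Import cardinality.
From mathcomp Require Import zify ring.

Set Implicit Arguments.
Unset Strict Implicit.
Unset Printing Implicit Defensive.

Import GRing.Theory.

Local Open Scope classical_set_scope.
Local Open Scope ring_scope.

(** Filtering an ideal I of F by the quasi-coherent steps gives homogeneous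
    generators g_1, ..., g_s of I, of degrees at most d, such that each colon
    ideal ((g_1, ..., g_(r-1)) : g_r) is a proper ideal J_r of F. The relations
    between generators of this kind are generated by lifts of the generators of
    the J_r, and these lifts again have colon ideals in F. Hence:
    - I has boundedly many generators and relations, in degrees at most 2d. The
      Hilbert function of I is given by ranks of matrices depending linearly on
      the coordinates of the generators, and exactness makes it locally constant
      for the Zariski topology; so Hilbert's basis theorem leaves only finitely
      many Hilbert series of proper ideals of F;
    - I(z) = \sum_r z^(t_r) (A(z) - J_r(z)) with t_r > 0, a finite linear system
      with a matrix congruent to 1 modulo z, which proves (i);
    - if d = 1, the minimal resolution of I is linear, so that
      I(z) = z^e A(z) P_I(-z) with e = 1 (or e = 0 if I = A), and (ii) follows
      from (i). *)

(** * Hilbert's basis theorem *)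

(** The colon ideals J_r are in general new ideals of F with no decreasing measure, so unfolding the
    recursion for I(z) may produce infinitely many unknowns: finiteness of the set of Hilbert series
    has to come first. The number of generators is bounded because each step of the filtration loses
    an element of degree at most d, hence lowers the dimension of the part in degrees at most d.

    The rank of a matrix of linear forms is only lower semicontinuous, and infinitely many degrees n
    must be treated with the same finitely many parameters. So a parameter point records generators
    together with generating relations: in every degree n the two ranks add up to the dimension of a
    free module fixed by the degrees of the generators alone, and neither rank can rise without the
    other falling.

    Properness makes t_r positive, as a generator of degree 0 would be a scalar, zero or invertible;
    it passes to J_r because the inclusions in the filtration are strict. *)

Lemma history_choice (T : Type) (pick : seq T -> T) :
  exists g : nat -> T, forall n, g n = pick (mkseq g n).
Proof.
pose L := fix L n := if n is m.+1 then rcons (L m) (pick (L m)) else [::].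
exists (fun n => pick (L n)) => n; congr (pick _).
by elim: n => [|n IH] //; rewrite mkseqS -IH.
Qed.

Section Noetherian.
Variable R : comNzRingType.
Implicit Types s : seq R.

Definition ideal_gen s : set R :=
  [set x | exists c : nat -> R, x = \sum_(i < size s) c i * s`_i].

(** The ascending chain condition in the form that [history_choice] can refute: a sequence whose
    terms are all picked outside the ideal of the previous ones cannot exist. *)
Definition noetherian : Prop :=
  forall f : nat -> R, exists n, ideal_gen (mkseq f n) (f n).

Lemma ideal_gen_mkseq (f : nat -> R) n x :
  ideal_gen (mkseq f n) x <-> exists c : nat -> R, x = \sum_(i < n) c i * f i.
Proof.
rewrite /ideal_gen /= size_mkseq.
by split=> -[c ->]; exists c; apply: eq_bigr => i _; rewrite nth_mkseq.
Qed.

Lemma ideal_gen0 s : ideal_gen s 0.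
Proof. by exists (fun=> 0); rewrite big1 // => i _; rewrite mul0r. Qed.

Lemma ideal_genD s x y : ideal_gen s x -> ideal_gen s y -> ideal_gen s (x + y).
Proof.
move=> [c ->] [d ->]; exists (fun i => c i + d i).
by rewrite -big_split; apply: eq_bigr => i _; rewrite mulrDl.
Qed.

Lemma ideal_genM s a x : ideal_gen s x -> ideal_gen s (a * x).
Proof.
move=> [c ->]; exists (fun i => a * c i).
by rewrite mulr_sumr; apply: eq_bigr => i _; rewrite mulrA.
Qed.

Lemma ideal_gen_mem s x : x \in s -> ideal_gen s x.
Proof.
move=> xs; exists (fun i => (i == index x s)%:R).
have lt_i : (index x s < size s)%N by rewrite index_mem.
rewrite (bigD1 (Ordinal lt_i)) //= eqxx mul1r nth_index // big1 ?addr0 //.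
by move=> i ne; rewrite (_ : (i == _ :> nat) = false) ?mul0r //; apply: negbTE.
Qed.

Lemma ideal_gen_sum s n (F : 'I_n -> R) :
  (forall i, ideal_gen s (F i)) -> ideal_gen s (\sum_i F i).
Proof.
move=> Fs; elim/big_ind: _ => //; first exact: ideal_gen0.
by move=> x y; exact: ideal_genD.
Qed.

(** Noetherian induction on ideals, represented by lists of generators: a failure at s persists for
    some strictly larger ideal, and iterating from the empty list gives a sequence excluded by
    [noetherian]. *)
Lemma noetherian_ind (P : seq R -> Prop) : noetherian ->
  (forall s, (forall g, ~ ideal_gen s g -> P (rcons s g)) -> P s) -> P [::].
Proof.
move=> noeR step; apply: contrapT => nP0.
have /choice[pick pickP] s :
    exists g, ~ P s -> ~ ideal_gen s g /\ ~ P (rcons s g).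
  have [Ps|nPs] := pselect (P s); first by exists 0.
  apply: contrapT => nex; apply: nPs; apply: step => g gs.
  by apply: contrapT => nPg; apply: nex; exists g.
have [g gE] := history_choice pick.
have nP n : ~ P (mkseq g n).
  by elim: n => // n /pickP[_]; rewrite mkseqS -gE.
have [n gn] := noeR g.
by have [+ _] := pickP _ (nP n); rewrite -gE.
Qed.

End Noetherian.

Lemma noetherian_field (k : fieldType) : noetherian k.
Proof.
move=> f; have [f0|f0] := eqVneq (f 0%N) 0.
  by exists 0%N; rewrite f0; exact: ideal_gen0.
exists 1%N; apply/ideal_gen_mkseq; exists (fun=> f 1%N / f 0%N).
by rewrite big_ord1 divfK.
Qed.

(** The classical argument by leading coefficients: a polynomial of least degree outside the ideal
    of the earlier choices can be reduced by these once its leading coefficient is a combination of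
    theirs. *)
Lemma noetherian_poly (R : comNzRingType) :
  noetherian R -> noetherian {poly R}.
Proof.
move=> noeR f; apply: contrapT => nf.
pose J : set {poly R} := [set p | exists n, ideal_gen (mkseq f n) p].
have Jle m n p : (m <= n)%N -> ideal_gen (mkseq f m) p ->
    ideal_gen (mkseq f n) p.
  move=> le_mn /ideal_gen_mkseq[c ->]; apply: ideal_gen_sum => i.
  apply/ideal_genM/ideal_gen_mem/mapP; exists (i : nat) => //.
  by rewrite mem_iota; have := ltn_ord i; lia.
have JD p q : J p -> J q -> J (p + q).
  move=> [m pm] [n qn]; exists (maxn m n); apply: ideal_genD.
    exact: Jle (leq_maxl m n) pm.
  exact: Jle (leq_maxr m n) qn.
have JM p q : J q -> J (p * q) by move=> [m qm]; exists m; exact: ideal_genM.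
have Jsum n (F : 'I_n -> {poly R}) : (forall i, J (F i)) -> J (\sum_i F i).
  move=> JF; elim/big_ind: _ => //; first by exists 0%N; exact: ideal_gen0.
have notfg s : {in s, forall p, J p} -> exists2 p, J p & ~ ideal_gen s p.
  move=> Js; have [n sn] : exists n, {in s, forall p, ideal_gen (mkseq f n) p}.
    elim: s Js => [|p s IH] Js; first by exists 0%N.
    have [n sn] : exists n, {in s, forall p, ideal_gen (mkseq f n) p}.
      by apply: IH => q qs; apply: Js; rewrite inE qs orbT.
    have [m pm] := Js p (mem_head _ _).
    exists (maxn m n) => q; rewrite inE => /predU1P[->|/sn].
      exact: Jle (leq_maxl m n) pm.
    exact/Jle/leq_maxr.
  have Jfn : J (f n).
    by exists n.+1; apply: ideal_gen_mem; rewrite mkseqS mem_rcons mem_head.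
  exists (f n) => // -[c fnE]; apply: nf; exists n; rewrite fnE.
  by apply: ideal_gen_sum => i; apply/ideal_genM/sn/mem_nth.
have /choice[pick pickP] s : exists p, {in s, forall p, J p} ->
    [/\ J p, ~ ideal_gen s p &
        forall q, J q -> ~ ideal_gen s q -> (size p <= size q)%N].
  have [Js|nJs] := pselect {in s, forall p, J p}; last by exists 0.
  have [p0 Jp0 np0] := notfg s Js.
  pose Q m := `[< exists p, [/\ J p, ~ ideal_gen s p & size p = m] >].
  have exQ : exists m, Q m by exists (size p0); apply/asboolP; exists p0.
  have [m /asboolP[p [Jp np <-]] mmin] := ex_minnP exQ.
  exists p => _; split=> // q Jq nq; apply: mmin.
  by apply/asboolP; exists q.
have [g gE] := history_choice pick.
have Jg n : {in mkseq g n, forall p, J p}.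
  elim: n => [|n IH] p; first by rewrite in_nil.
  rewrite mkseqS mem_rcons inE => /predU1P[->|/IH//].
  by have [] := pickP _ IH; rewrite -gE.
have gP n : [/\ J (g n), ~ ideal_gen (mkseq g n) (g n) &
    forall q, J q -> ~ ideal_gen (mkseq g n) q -> (size (g n) <= size q)%N].
  by have := pickP _ (Jg n); rewrite -gE.
have gmono i n : (i <= n)%N -> (size (g i) <= size (g n))%N.
  move=> le_in; have [_ _] := gP i; apply; first by case: (gP n).
  have [_ ngn _] := gP n; apply: contra_not ngn => /ideal_gen_mkseq[c ->].
  apply: ideal_gen_sum => j; apply/ideal_genM/ideal_gen_mem/mapP.
  by exists (j : nat) => //; rewrite mem_iota; have := ltn_ord j; lia.
have [n /ideal_gen_mkseq[c lcE]] := noeR (fun n => lead_coef (g n)).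
have [Jgn ngn gmin] := gP n.
(* The monomials raise each g i to the degree of g n, so h has the leading term of g n and g n - h
   has smaller size. The subtraction of sizes is exact by [gmono]. *)
pose h := \sum_(i < n) (c i *: 'X^(size (g n) - size (g i))) * g i.
have hJ : ideal_gen (mkseq g n) h.
  apply: ideal_gen_sum => i; apply/ideal_genM/ideal_gen_mem/mapP.
  by exists (i : nat) => //; rewrite mem_iota /= add0n ltn_ord.
have nq : ~ ideal_gen (mkseq g n) (g n - h).
  by apply: contra_not ngn => /ideal_genD/(_ hJ); rewrite subrK.
have Jh : J h.
  by apply: Jsum => i; apply: JM; case: (gP i).
have JB : J (g n - h) by apply: JD => //; rewrite -mulN1r; exact: JM.
have gn0 : g n != 0.
  by apply/eqP => g0; apply: ngn; rewrite g0; exact: ideal_gen0.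
move: (gmin _ JB nq); apply/negP; rewrite -ltnNge.
rewrite -[ltnRHS](@prednK (size (g n))) ?size_poly_gt0 // ltnS.
apply/leq_sizeP => j; rewrite leq_eqVlt => /predU1P[<-|lt_j].
  rewrite coefB -lead_coefE lcE /h coef_sum -sumrB big1 // => i _.
  rewrite -scalerAl coefZ coefXnM.
  have le_in := gmono i n (ltnW (ltn_ord i)).
  have gi0 : (0 < size (g i))%N.
    rewrite size_poly_gt0; apply/eqP => g0; have [_ + _] := gP i.
    by apply; rewrite g0; exact: ideal_gen0.
  rewrite ifF; last by lia.
  rewrite lead_coefE (_ : (_.-1 - _)%N = (size (g i)).-1) ?subrr //; lia.
have lej : (size (g n) <= j)%N by lia.
rewrite coefB (nth_default _ lej) sub0r /h coef_sum big1 ?oppr0 // => i _.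
rewrite -scalerAl coefZ coefXnM.
have le_in := gmono i n (ltnW (ltn_ord i)).
rewrite ifF; last by lia.
by rewrite nth_default ?mulr0 //; apply: leq_trans (leq_sub2r _ lej); rewrite subKn.
Qed.

(** R is an iterated polynomial ring, known only through its evaluations: X is the generic point of
    affine N-space, and [ev] specialises it to a given k-point. *)
Lemma noetherian_generic_point (k : fieldType) N :
  exists (R : comNzRingType) (inj : {rmorphism k -> R}) (X : 'I_N -> R),
    noetherian R /\ forall x : 'I_N -> k, exists ev : {rmorphism R -> k},
      (forall c, ev (inj c) = c) /\ forall i, ev (X i) = x i.
Proof.
elim: N => [|N [R [inj [X [noeR evR]]]]].
  exists k, (idfun : {rmorphism k -> k}), (fun=> 0).
  split=> [|x]; first exact: noetherian_field.
  by exists (idfun : {rmorphism k -> k}); split=> // -[].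
exists {poly R}, (polyC \o inj : {rmorphism k -> {poly R}}).
exists (fun i => if unlift ord0 i is Some j then (X j)%:P else 'X).
split=> [|x]; first exact: noetherian_poly.
have [ev [evi evX]] := evR (fun i => x (lift ord0 i)).
pose e0 := ev \o horner_eval (inj (x ord0)).
exists (e0 : {rmorphism {poly R} -> k}); split=> [c|i] /=.
  by rewrite /e0 /= /horner_eval hornerC evi.
rewrite /e0 /= /horner_eval; case: unliftP => [j|] ->.
  by rewrite hornerC evX.
by rewrite hornerX evi.
Qed.
(** * Pencils of matrices with constant rank sum *)

(** P and Q stand for a nonzero minor of maximal size, without a choice of rows and columns. *)
Lemma rank_witness (k : fieldType) m n (A : 'M[k]_(m, n)) :
  exists (P : 'M_(\rank A, m)) (Q : 'M_(n, \rank A)), P *m A *m Q = 1%:M.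
Proof.
have /row_freeP[Q rQ] := row_base_free A.
have /submxP[P defA] : (row_base A <= A)%MS by rewrite eq_row_base.
by exists P, Q; rewrite -defA.
Qed.

Lemma rank_ge_det (k : fieldType) r m n (A : 'M[k]_(m, n))
    (P : 'M_(r, m)) (Q : 'M_(n, r)) :
  \det (P *m A *m Q) != 0 -> (r <= \rank A)%N.
Proof.
move=> detN0; have : row_free (P *m A *m Q).
  by rewrite row_free_unit unitmxE unitfE.
move=> /eqP rk; rewrite -{1}rk -mulmxA.
by apply: leq_trans (mxrankM_maxr _ _) (mxrankM_maxl _ _).
Qed.

Section RankStrata.
Variables (k : fieldType) (T : finType).

Definition pencil m n (M : T -> 'M[k]_(m, n)) (x : T -> k) : 'M_(m, n) :=
  \sum_t x t *: M t.

Variables (R : comNzRingType) (inj : {rmorphism k -> R}) (X : T -> R).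
Variable ev : (T -> k) -> {rmorphism R -> k}.
Hypothesis ev_inj : forall x c, ev x (inj c) = c.
Hypothesis ev_X : forall x t, ev x (X t) = x t.

(** The witnesses P and Q of the rank at x0 are kept fixed while the matrix varies: the determinant
    of P times the generic matrix times Q lies in R and takes the value 1 at x0. *)
Lemma rank_lower_semicontinuous m n (M : T -> 'M[k]_(m, n)) (x0 : T -> k) :
  exists g : R, ev x0 g != 0 /\
    forall x, ev x g != 0 -> (\rank (pencil M x0) <= \rank (pencil M x))%N.
Proof.
have [P [Q PQ]] := rank_witness (pencil M x0).
pose gen := \sum_t X t *: map_mx inj (M t).
have evK x p q (N : 'M_(p, q)) : map_mx (ev x) (map_mx inj N) = N.
  by apply/matrixP => i j; rewrite !mxE ev_inj.
have ev_gen x : map_mx (ev x) gen = pencil M x.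
  rewrite /gen raddf_sum; apply: eq_bigr => t _.
  by rewrite /= map_mxZ evK ev_X.
exists (\det (map_mx inj P *m gen *m map_mx inj Q)).
have evE x : ev x (\det (map_mx inj P *m gen *m map_mx inj Q)) =
             \det (P *m pencil M x *m Q).
  by rewrite -det_map_mx !map_mxM !evK ev_gen.
split=> [|x]; rewrite evE; first by rewrite PQ det1 oner_eq0.
exact: rank_ge_det.
Qed.

Variables (m1 m2 m3 : nat -> nat).
Variables (Phi : forall n, T -> 'M[k]_(m1 n, m2 n)).
Variables (Psi : forall n, T -> 'M[k]_(m2 n, m3 n)).
Variables (c : nat -> nat) (G : set (T -> k)).
Hypothesis rank_sum : forall x n, G x ->
  (\rank (pencil (Phi n) x) + \rank (pencil (Psi n) x) = c n)%N.
Hypothesis noeR : noetherian R.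

(* As the two ranks have constant sum, both are locally constant on G for the
   Zariski topology. *)
Lemma finite_rank_functions_noeth :
  finite_set [set h : nat -> nat | exists2 x, G x &
                forall n, h n = \rank (pencil (Psi n) x)].
Proof.
pose rk x n := \rank (pencil (Psi n) x).
pose V (s : seq R) : set (T -> k) :=
  [set x | G x /\ forall f, f \in s -> ev x f = 0].
suff : finite_set (rk @` V [::]).
  apply: sub_finite_set => h [x Gx hE]; exists x; last exact/esym/funext.
  by split=> // f; rewrite in_nil.
apply: (noetherian_ind (P := fun s => finite_set (rk @` V s)) noeR) => s IH.
have [[x0 [x1 [n [V0 V1 ne]]]]|const] := pselect (exists x0 x1 n,
    [/\ V s x0, V s x1 & rk x0 n != rk x1 n]); last first.
  have [->|/set0P[x0 V0]] := eqVneq (V s) set0.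
    by rewrite image_set0; exact: finite_set0.
  apply: (sub_finite_set (B := [set rk x0])); last exact: finite_set1.
  move=> _ [x Vx <-]; apply/funext => n; apply/eqP/negPn/negP => ne.
  by apply: const; exists x, x0, n.
have sep x : V s x -> exists g : R, ev x g != 0 /\
    forall y, G y -> ev y g != 0 -> rk y n = rk x n.
  move=> [Gx _].
  have [g [gx gP]] := rank_lower_semicontinuous (Phi n) x.
  have [g' [g'x g'P]] := rank_lower_semicontinuous (Psi n) x.
  exists (g * g'); split=> [|y Gy]; first by rewrite rmorphM mulf_neq0.
  rewrite rmorphM mulf_eq0 negb_or => /andP[/gP le1 /g'P le2].
  have := rank_sum n Gx; have := rank_sum n Gy; rewrite /rk; lia.
have notin x g : V s x -> ev x g != 0 -> ~ ideal_gen s g.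
  move=> [_ xs] + [d gE]; rewrite gE rmorph_sum big1 ?eqxx // => i _.
  by rewrite rmorphM [X in _ * X]xs ?mulr0 // mem_nth.
have [g0 [g0x g0P]] := sep _ V0.
have [g1 [g1x g1P]] := sep _ V1.
have fin0 := IH _ (notin _ _ V0 g0x).
have fin1 := IH _ (notin _ _ V1 g1x).
(* A point of V s where neither g0 nor g1 vanishes would have both rk x0 n and rk x1 n as its n-th
   rank. So V s is covered by two closed subsets to which the induction applies. *)
apply: (sub_finite_set (B := rk @` V (rcons s g0) `|` rk @` V (rcons s g1)));
  last by rewrite finite_setU.
move=> _ [x [Gx xs] <-].
have [xg0|xg0] := eqVneq (ev x g0) 0.
  left; exists x => //; split=> // f; rewrite mem_rcons inE.
  by case/predU1P => [->|/xs].
right; exists x => //; split=> // f; rewrite mem_rcons inE.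
case/predU1P => [->|/xs//]; apply/eqP/negPn/negP => /(g1P _ Gx) e1.
by move: ne; rewrite -(g0P _ Gx xg0) e1 eqxx.
Qed.

End RankStrata.

Lemma finite_rank_functions (k : fieldType) (T : finType)
    (m1 m2 m3 : nat -> nat) (Phi : forall n, T -> 'M[k]_(m1 n, m2 n))
    (Psi : forall n, T -> 'M[k]_(m2 n, m3 n)) (c : nat -> nat)
    (G : set (T -> k)) :
  (forall x n, G x ->
    (\rank (pencil (Phi n) x) + \rank (pencil (Psi n) x) = c n)%N) ->
  finite_set [set h : nat -> nat | exists2 x, G x &
                forall n, h n = \rank (pencil (Psi n) x)].
Proof.
have [R [inj [X [noeR evR]]]] := noetherian_generic_point k #|T|.
have /choice[ev evP] (x : T -> k) : exists ev : {rmorphism R -> k},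
    (forall c, ev (inj c) = c) /\ forall t, ev (X (enum_rank t)) = x t.
  have [ev [evi evX]] := evR (fun i => x (enum_val i)).
  by exists ev; split=> // t; rewrite evX enum_rankK.
move=> rank_sum.
exact: (finite_rank_functions_noeth (ev := ev) (fun x => (evP x).1)
          (fun x => (evP x).2) rank_sum noeR).
Qed.

(** * Coordinates on the graded pieces *)

(** Among the matrices with rows in P take one of maximal rank: stacking a further vector of P on it
    cannot raise the rank. *)
Lemma subspace_matrix (k : fieldType) m (P : set 'rV[k]_m) :
  P 0 -> (forall c u v, P u -> P v -> P (c *: u + v)) ->
  exists U : 'M[k]_m, forall v, P v <-> (v <= U)%MS.
Proof.
move=> P0 PD.
have Psub p (M : 'M[k]_(p, m)) v : (forall i, P (row i M)) -> (v <= M)%MS -> P v.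
  move=> PM /submxP[c ->]; rewrite mulmx_sum_row.
  elim/big_ind: _ => // [x y Px Py|i _]; first by rewrite -[x]scale1r; exact: PD.
  by rewrite -[_ *: _]addr0; exact: PD.
pose Q r := `[< exists2 M : 'M[k]_m, forall i, P (row i M) & \rank M = r >].
have exQ : exists r, Q r.
  exists 0%N; apply/asboolP; exists 0; last by rewrite mxrank0.
  by move=> i; rewrite row0.
have Qle r : Q r -> (r <= m)%N by move=> /asboolP[M _ <-]; exact: rank_leq_row.
have [r /asboolP[M PM <-] Mmax] := ex_maxnP exQ Qle.
exists M => v; split=> [Pv|]; last exact: Psub.
pose M' := (M + v)%MS.
have PM' i : P (row i M').
  have := row_sub i M'; rewrite addsmxE => /(Psub _ _ _ _); apply=> j.
  by have [j' ->|j' ->] := split_ordP j; rewrite ?rowKu ?rowKd ?row_id.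
have le1 : (\rank M' <= \rank M)%N by apply: Mmax; apply/asboolP; exists M'.
have := mxrank_leqif_sup (addsmxSl M v).
move=> [le2 eqr]; have: \rank M == \rank M' by rewrite eqn_leq le2 le1.
by rewrite eqr addsmx_sub => /andP[].
Qed.

(** A complement of the relations among the e i maps isomorphically onto Z, so no basis has to be
    extracted. The values of [cd] are meaningful on Z only. *)
Lemma subspace_coordinates (k : fieldType) (V : lmodType k) (Z : set V)
    m (e : 'I_m -> V) :
  (forall i, Z (e i)) -> Z 0 ->
  (forall c x y, Z x -> Z y -> Z (c *: x + y)) ->
  (forall x, Z x -> exists c : 'I_m -> k, x = \sum_i c i *: e i) ->
  exists p (E : {linear 'rV[k]_p -> V}) (cd : V -> 'rV[k]_p),
    [/\ forall c, Z (E c), forall c, cd (E c) = c & forall x, Z x -> E (cd x) = x].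
Proof.
move=> Ze Z0 ZD spanZ.
pose F (c : 'rV[k]_m) := \sum_i c 0 i *: e i.
have Flin : linear F.
  move=> a u v; rewrite /F scaler_sumr -big_split; apply: eq_bigr => i _.
  by rewrite !mxE scalerDl scalerA.
have Fl a u v : F (a *: u + v) = a *: F u + F v by exact: Flin.
have F0 : F 0 = 0 by rewrite /F big1 // => i _; rewrite mxE scale0r.
have [U UP] : exists U : 'M[k]_m, forall v, F v = 0 <-> (v <= U)%MS.
  apply: subspace_matrix => [//|c u v Fu Fv].
  by rewrite Fl Fu Fv scaler0 addr0.
pose B := row_base (U^C)%MS.
pose E0 (c : 'rV[k]_(\rank (U^C)%MS)) := F (c *m B).
have E0lin : linear E0.
  by move=> a u v; rewrite /E0 mulmxDl -scalemxAl Fl.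
pose EL := GRing.isLinear.Build k _ V *:%R E0 E0lin.
pose E : {linear 'rV[k]_(\rank (U^C)%MS) -> V} := HB.pack E0 EL.
have Einj c : E c = 0 -> c = 0.
  move=> /UP cU; have cC : (c *m B <= U^C)%MS.
    by apply: submx_trans (submxMl _ _) _; rewrite eq_row_base.
  have : (c *m B <= U :&: U^C)%MS by rewrite sub_capmx cU.
  rewrite capmx_compl submx0 => /eqP cB.
  by apply: (row_free_inj (row_base_free (U^C)%MS)); rewrite cB mul0mx.
have Esurj x : Z x -> exists c, E c = x.
  move=> /spanZ[d xE].
  have : (\row_i d i <= U + U^C)%MS by apply: submx_full; exact: addsmx_compl_full.
  case/sub_addsmxP => -[u w] /= dE.
  have /submxP[c cE] : (w *m (U^C)%MS <= B)%MS.
    by rewrite eq_row_base; exact: submxMl.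
  exists c; rewrite /E /= /E0 -cE.
  have -> : x = F (\row_i d i).
    by rewrite xE; apply: eq_bigr => i _; rewrite mxE.
  rewrite dE -[u *m U]scale1r Fl (UP (u *m U)).2 ?submxMl //.
  by rewrite scaler0 add0r.
have /choice[cd cdP] x : exists c, Z x -> E c = x.
  by have [/Esurj[c cE]|nZ] := pselect (Z x); [exists c | exists 0].
have ZE c : Z (E c).
  rewrite /E /= /E0 /F; elim/big_ind: _ => // [x y Zx Zy|i _].
    by rewrite -[x]scale1r; exact: ZD.
  by rewrite -[_ *: _]addr0; exact: ZD.
exists _, E, cd; split=> // c.
by apply/subr0_eq/Einj; rewrite linearB /= [E0 (cd _)]cdP ?subrr.
Qed.

Section Span.
Variables (k : fieldType) (V : lmodType k).

Definition lin_span (s : seq V) : set V :=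
  [set x | exists c : nat -> k, x = \sum_(i < size s) c i *: s`_i].

Lemma lin_span0 s : lin_span s 0.
Proof. by exists (fun=> 0); rewrite big1 // => i _; rewrite scale0r. Qed.

Lemma lin_spanP s c x y :
  lin_span s x -> lin_span s y -> lin_span s (c *: x + y).
Proof.
move=> [a ->] [b ->]; exists (fun i => c * a i + b i).
rewrite scaler_sumr -big_split; apply: eq_bigr => i _.
by rewrite scalerDl scalerA.
Qed.

Lemma lin_spanD s x y : lin_span s x -> lin_span s y -> lin_span s (x + y).
Proof. by rewrite -{2}[x]scale1r; exact: lin_spanP. Qed.

Lemma lin_spanZ s c x : lin_span s x -> lin_span s (c *: x).
Proof. by move=> sx; rewrite -[_ *: _]addr0; apply: lin_spanP (lin_span0 _). Qed.

Lemma lin_span_sum s I (r : seq I) (P : pred I) (F : I -> V) :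
  (forall i, P i -> lin_span s (F i)) -> lin_span s (\sum_(i <- r | P i) F i).
Proof.
by move=> Fs; elim/big_ind: _ => //; [exact: lin_span0 | exact: lin_spanD].
Qed.

Lemma lin_span_mem s x : x \in s -> lin_span s x.
Proof.
move=> xs; exists (fun i => (i == index x s)%:R).
have lt_i : (index x s < size s)%N by rewrite index_mem.
rewrite (bigD1 (Ordinal lt_i)) //= eqxx scale1r nth_index // big1 ?addr0 //.
by move=> i ne; rewrite (_ : (i == _ :> nat) = false) ?scale0r //; apply: negbTE.
Qed.

End Span.

Lemma lin_span_map (k : fieldType) (V W : lmodType k) (f : {linear V -> W})
    (s : seq V) (s' : seq W) x :
  (forall y, y \in s -> lin_span s' (f y)) -> lin_span s x -> lin_span s' (f x).
Proof.
move=> fs [c ->]; rewrite linear_sum; apply: lin_span_sum => i _.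
by rewrite linearZ; apply/lin_spanZ/fs/mem_nth.
Qed.

Lemma malgU_scale (k : fieldType) n (c : k) (m : {fmonom 'I_n}) :
  << c *g m >> = c *: << m >> :> {malg k[{fmonom 'I_n}]}.
Proof.
by apply/malgP => m'; rewrite mcoeffZ !mcoeffU mulrnAr mulr1.
Qed.

Lemma malgU_cons (k : fieldType) n (i : 'I_n) s :
  << FMonom (i :: s) >> =
  << fmu i >> * << FMonom s >> :> {malg k[{fmonom 'I_n}]}.
Proof.
rewrite malgM_def fgmulUU mulr1; congr << _ >>.
by rewrite /mmul /= fmmulE fmuE.
Qed.

Lemma malg_monomial_ind (k : fieldType) n (P : set {malg k[{fmonom 'I_n}]}) :
  P 0 -> (forall x y, P x -> P y -> P (x + y)) ->
  (forall c x, P x -> P (c *: x)) -> P 1 ->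
  (forall i x, P x -> P (<< fmu i >> * x)) -> forall f, P f.
Proof.
move=> P0 PD PZ P1 PM f; rewrite [f]monalgE.
apply: (big_ind P) => // m _; rewrite malgU_scale; apply: PZ.
case: m => s; elim: s => [|i s IH]; first by rewrite -fmoneE.
by rewrite malgU_cons; exact: PM.
Qed.

(** * Homogeneous components and local finiteness *)

Section Grading.
Variables (k : fieldType) (A : algType k) (gr : nat -> set A).
Hypothesis grA : connected_grading gr.

Lemma grD i x y : gr i x -> gr i y -> gr i (x + y).
Proof. by move=> gx gy; rewrite -[x]scale1r; exact: gr_linear. Qed.

Lemma grZ i c x : gr i x -> gr i (c *: x).
Proof. by move=> gx; rewrite -[_ *: _]addr0; apply: gr_linear (gr_zero _ _). Qed.

Lemma grN i x : gr i x -> gr i (- x).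
Proof. by rewrite -scaleN1r; exact: grZ. Qed.

Lemma gr_scalar c : gr 0 c%:A.
Proof. by rewrite (gr_connected grA); exists c. Qed.

Lemma gr_one : gr 0 1.
Proof. by rewrite -[1]scale1r; exact: gr_scalar. Qed.

(** All sufficiently long partial sums equal x, so that two decompositions can be compared at a
    common length. *)
Definition graded_decomposition (x : A) (a : nat -> A) : Prop :=
  (forall i, gr i (a i)) /\ exists n, forall m, (n <= m)%N ->
    x = \sum_(i < m) a i.

Lemma ord_sum_truncate n m (a : nat -> A) : (n <= m)%N ->
  \sum_(i < n) a i = \sum_(i < m) (if (i < n)%N then a i else 0).
Proof. by move=> le_nm; rewrite (big_ord_widen _ _ le_nm) big_mkcond. Qed.

Lemma graded_decomposition_exists x : exists a, graded_decomposition x a.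
Proof.
have [n [a [ga ->]]] := gr_span grA x.
exists (fun i => if (i < n)%N then a i else 0); split=> [i|].
  by case: ifP => _ //; exact: gr_zero.
by exists n => m le_nm; exact: ord_sum_truncate.
Qed.

Lemma graded_decomposition_unique x a b :
  graded_decomposition x a -> graded_decomposition x b -> a = b.
Proof.
move=> [ga [n xa]] [gb [m xb]]; apply/funext => i.
pose N := maxn i.+1 (maxn n m).
apply/subr0_eq; apply: (gr_direct grA (n := N) (a := fun i => a i - b i)) => //.
- by move=> j; apply: grD => //; exact: grN.
- by rewrite sumrB -xa -?xb ?subrr // /N; lia.
- by rewrite /N; lia.
Qed.

Definition components (x : A) : nat -> A :=
  sval (cid (graded_decomposition_exists x)).
Definition hcomp (j : nat) (x : A) : A := components x j.

Lemma componentsP x : graded_decomposition x (hcomp^~ x).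
Proof. exact: svalP (cid (graded_decomposition_exists x)). Qed.

Lemma gr_hcomp j x : gr j (hcomp j x).
Proof. by have [] := componentsP x. Qed.

Lemma hcomp_eq x a j : graded_decomposition x a -> hcomp j x = a j.
Proof. by move=> xa; rewrite -(graded_decomposition_unique (componentsP x) xa). Qed.

Lemma hcomp_is_linear j : linear (hcomp j).
Proof.
move=> c x y; apply: (hcomp_eq (a := fun j => c *: hcomp j x + hcomp j y)).
have [gx [n xn]] := componentsP x; have [gy [m ym]] := componentsP y.
split=> [i|]; first exact: gr_linear.
exists (maxn n m) => p; rewrite geq_max => /andP[/xn xp /ym yp].
rewrite [in LHS]xp [in LHS]yp.
by rewrite scaler_sumr -big_split.
Qed.

HB.instance Definition _ j := GRing.isLinear.Build k A A *:%R (hcomp j)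
  (hcomp_is_linear j).

Lemma hcomp_gr i j x : gr i x -> hcomp j x = if i == j then x else 0.
Proof.
move=> gx; apply: (hcomp_eq (a := fun j => if i == j then x else 0)).
split=> [l|]; first by case: eqP => [<-|_] //; exact: gr_zero.
exists i.+1 => m lt_im; rewrite (bigD1 (Ordinal lt_im)) //= eqxx big1 ?addr0 //.
move=> l ne; rewrite ifN //; apply: contra ne => /eqP e.
by apply/eqP/val_inj.
Qed.

Lemma sum_hcomp x : exists n, forall m, (n <= m)%N -> x = \sum_(i < m) hcomp i x.
Proof. by have [] := componentsP x. Qed.

Lemma sum_shift (V : zmodType) e m (F : nat -> V) : (e <= m)%N ->
  \sum_(i < m) (if (e <= i)%N then F (i - e)%N else 0) = \sum_(i < m - e) F i.
Proof.
move=> le_em; rewrite -(big_mkord xpredT F).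
rewrite -(big_mkord xpredT (fun i => if (e <= i)%N then F (i - e)%N else 0)).
rewrite (big_cat_nat (n := e)) //= big_nat_cond big1 ?add0r; last first.
  by move=> i /andP[/andP[_ lt_ie] _]; rewrite leqNgt lt_ie.
rewrite -{1}[e]add0n big_addn; apply: eq_bigr => i _.
by rewrite leq_addl addnK.
Qed.

Lemma hcomp_mull e j y x : gr e y ->
  hcomp j (y * x) = if (e <= j)%N then y * hcomp (j - e) x else 0.
Proof.
move=> gy; pose a j := if (e <= j)%N then y * hcomp (j - e) x else 0.
apply: (hcomp_eq (a := a)); split=> [i|].
  rewrite /a; case: leqP => [le_ei|_]; last exact: gr_zero.
  by rewrite -{1}(subnKC le_ei); apply: (gr_mul grA) => //; exact: gr_hcomp.
have [n xn] := sum_hcomp x; exists (e + n)%N => m le_m.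
rewrite /a (sum_shift (fun i => y * hcomp i x)); last by lia.
by rewrite [in LHS](xn (m - e)%N) ?mulr_sumr //; lia.
Qed.

Lemma gr0_scalar x : gr 0 x -> exists c, x = c%:A.
Proof. by rewrite (gr_connected grA). Qed.

Lemma augmentation_idealE x : augmentation_ideal gr x <-> hcomp 0 x = 0.
Proof.
split=> [[n [a [ga ->]]]|x0].
  by rewrite linear_sum big1 // => i _; exact: hcomp_gr (ga i).
have [n xn] := sum_hcomp x.
exists n, (fun i => hcomp i.+1 x); split=> [i|]; first exact: gr_hcomp.
by rewrite [LHS](xn n.+1) // big_ord_recl x0 add0r.
Qed.

Section FiniteDimension.
Variables (n : nat) (phi : {lrmorphism {malg k[{fmonom 'I_n}]} -> A}).
Hypothesis phi_surj : forall a, exists f, phi f = a.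

Definition generator (i : 'I_n) : A := phi << fmu i >>.

(* The products of at most j positive-degree components of the generators:
   as these have degree at least 1, they span the degree j part. *)
Fixpoint words (N j : nat) : seq A :=
  if j is j'.+1 then
    1 :: [seq hcomp u.2.+1 (generator u.1) * x |
            u : 'I_n * 'I_N <- enum {: 'I_n * 'I_N}, x <- words N j']
  else [:: 1].

Lemma words_subset N i j : (i <= j)%N -> {subset words N i <= words N j}.
Proof.
elim: i j => [|i IH] [|j] le_ij x //=; rewrite !inE; first by move=> ->.
case/predU1P => [->|]; first by rewrite eqxx.
case/allpairsP => -[u y] [/= us yw ->]; apply/orP; right.
by apply/allpairsP; exists (u, y); split=> //=; exact: IH yw.
Qed.

Lemma lin_span_words_le N i j x : (i <= j)%N ->
  lin_span (words N i) x -> lin_span (words N j) x.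
Proof.
move=> le_ij; apply: (lin_span_map (f := idfun)) => y yw.
exact/lin_span_mem/(words_subset le_ij).
Qed.

Lemma lin_span_words_mul N i e j x : (e < N)%N -> (e < j)%N ->
  lin_span (words N (j - e.+1)) x ->
  lin_span (words N j) (hcomp e.+1 (generator i) * x).
Proof.
move=> lt_eN lt_ej sx.
have := lin_span_words_le (j := j.-1) _ sx; rewrite -(prednK (n := j)); last lia.
move=> /(_ ltac:(lia)) /=.
apply: (lin_span_map (f := hcomp e.+1 (generator i) \*o idfun)) => y yw /=.
apply: lin_span_mem; rewrite /= inE; apply/orP; right.
apply/allpairsP; exists ((i, Ordinal lt_eN), y); split=> //=.
by rewrite mem_enum.
Qed.

(** Induction on monomials peels off one generator at a time. Its component of degree e+1 costs one
    letter and lowers the remaining degree; its component of degree 0 is a scalar and costs none. *)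
Lemma gr_spanned : exists N, forall j x, gr j x -> lin_span (words N j) x.
Proof.
have /choice[b bP] i : exists m, forall m', (m <= m')%N ->
    generator i = \sum_(e < m') hcomp e (generator i).
  exact: sum_hcomp.
pose N := \max_i b i.
(* One more term than the bound: index 0 is treated apart, and the indices e.+1 with e < N are the
   letters available in [words]. *)
have genE i : generator i = \sum_(e < N.+1) hcomp e (generator i).
  by apply/bP/leqW/leq_bigmax.
exists N => j x gx.
have <- : hcomp j x = x by rewrite (hcomp_gr _ gx) eqxx.
have [f <-] := phi_surj x; move: j {gx}.
pose P f := forall j, lin_span (words N j) (hcomp j (phi f)).
apply: (malg_monomial_ind (P := P)) => {x f} [j|f g Pf Pg j|c f Pf j|j|i f Pf j].
- by rewrite !linear0; exact: lin_span0.
- by rewrite !linearD; exact: lin_spanD.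
- by rewrite !linearZ; exact: lin_spanZ.
- rewrite rmorph1 (hcomp_gr _ gr_one); case: eqP => _; last exact: lin_span0.
  by apply: (lin_span_words_le (leq0n _)); apply: lin_span_mem; rewrite inE.
rewrite rmorphM /= -/(generator i) genE mulr_suml linear_sum.
apply: lin_span_sum => -[e lt_e] _ /=.
rewrite (hcomp_mull _ _ (gr_hcomp e _)).
case: e lt_e => [|e] lt_e.
  rewrite /= subn0; have [c ->] := gr0_scalar (gr_hcomp 0 (generator i)).
  by rewrite mulr_algl; exact/lin_spanZ.
case: ifP => [lt_ej|_]; last exact: lin_span0.
exact: lin_span_words_mul.
Qed.

End FiniteDimension.

End Grading.

(** * Projections and coordinates for the shifted modules A[-t] *)

Section ShiftedPieces.
Variables (k : fieldType) (A : algType k) (gr : nat -> set A).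
Hypothesis grA : connected_grading gr.

Definition proj (t n : nat) (x : A) : A :=
  if (t <= n)%N then hcomp grA (n - t) x else 0.

Lemma proj_is_linear t n : linear (proj t n).
Proof.
move=> c x y; rewrite /proj; case: ifP => _; first exact: linearP.
by rewrite scaler0 addr0.
Qed.

HB.instance Definition _ t n := GRing.isLinear.Build k A A *:%R (proj t n)
  (proj_is_linear t n).

Lemma shift_grading_proj t n x : shift_grading gr t n (proj t n x).
Proof.
by rewrite /shift_grading /proj; case: ifP => // _; exact: gr_hcomp.
Qed.

Lemma proj_id t n x : shift_grading gr t n x -> proj t n x = x.
Proof.
rewrite /shift_grading /proj; case: ifP => // _ gx.
by rewrite (hcomp_gr _ _ gx) eqxx.
Qed.

(** An element of degree w - t acts by left multiplication as a degree-preserving map A[-w] -> A[-t]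
    of right modules. *)
Lemma proj_mull t w n a x : shift_grading gr t w a ->
  proj t n (a * x) = a * proj w n x.
Proof.
rewrite /shift_grading /proj; case: ifP => [le_tw ga|_ ->]; last first.
  by rewrite !mul0r linear0; case: ifP.
case: leqP => [le_tn|lt_nt]; last by rewrite ifF ?mulr0 //; lia.
rewrite (hcomp_mull grA _ _ ga).
have -> : (w - t <= n - t)%N = (w <= n)%N by lia.
case: ifP => [le_wn|]; last by rewrite mulr0.
by congr (_ * hcomp _ _ _); lia.
Qed.

Lemma graded_coordinates : finitely_presented A ->
  exists (hS : nat -> nat -> nat) (E : forall t n, {linear 'rV[k]_(hS t n) -> A})
    (cd : forall t n, {linear A -> 'rV[k]_(hS t n)}),
    (forall t n c, cd t n (E t n c) = c) /\
    (forall t n x, E t n (cd t n x) = proj t n x).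
Proof.
move=> [m [phi [_ [phi_surj _]]]].
have [N spanN] := gr_spanned grA phi_surj.
have coord (tn : nat * nat) : exists p (E : {linear 'rV[k]_p -> A})
    (cd : {linear A -> 'rV[k]_p}),
    (forall c, cd (E c) = c) /\ (forall x, E (cd x) = proj tn.1 tn.2 x).
  case: tn => t n /=.
  pose w := words grA phi N (n - t).
  pose e (i : 'I_(size w)) := proj t n w`_i.
  have [||||p [E [cd [ZE cdE Ecd]]]] :=
      @subspace_coordinates k A (shift_grading gr t n) _ e.
  - by move=> i; exact: shift_grading_proj.
  - by rewrite /shift_grading; case: ifP => // _; exact: gr_zero.
  - rewrite /shift_grading; case: ifP => _ c x y; first exact: gr_linear.
    by move=> -> ->; rewrite scaler0 addr0.
  - move=> x gx; have : lin_span w x \/ x = 0.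
      by move: gx; rewrite /shift_grading; case: ifP => _ gx;
        [left; exact: spanN | right].
    case=> [[c xE]|->]; last first.
      by exists (fun=> 0); rewrite big1 // => i _; rewrite scale0r.
    exists (fun i => c i); rewrite -(proj_id gx) {1}xE linear_sum.
    by apply: eq_bigr => i _; rewrite linearZ.
  have Einj c d : E c = E d -> c = d by move=> /(congr1 cd); rewrite !cdE.
  (* The chosen coordinates are controlled only on the graded piece; composing with the projection
     makes them linear on all of A. *)
  have cdlin : linear (cd \o proj t n).
    move=> c x y /=; apply: Einj.
    rewrite [RHS]linearP /= !Ecd ?linearP //; try exact: shift_grading_proj.
    by rewrite -linearP; exact: shift_grading_proj.
  pose L := GRing.isLinear.Build k A _ *:%R (cd \o proj t n) cdlin.
  pose cdL : {linear A -> 'rV[k]_p} := HB.pack (cd \o proj t n) L.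
  exists p, E, cdL; split=> [c|x]; rewrite /cdL /=; first by rewrite proj_id.
  by rewrite Ecd //; exact: shift_grading_proj.
pose hS tn := sval (cid (coord tn)).
have coordE tn := svalP (cid (coord tn)).
pose E tn := sval (cid (coordE tn)).
have coordcd tn := svalP (cid (coordE tn)).
pose cd tn := sval (cid (coordcd tn)).
have cdP tn := svalP (cid (coordcd tn)).
exists (fun t n => hS (t, n)), (fun t n => E (t, n)), (fun t n => cd (t, n)).
by split=> t n; [exact: (cdP (t, n)).1 | exact: (cdP (t, n)).2].
Qed.

End ShiftedPieces.

(** * Degree n parts of graded free modules and of maps between them *)

Section GradedPieces.
Variables (k : fieldType) (A : algType k) (gr : nat -> set A).
Hypothesis grA : connected_grading gr.
Variables (hS : nat -> nat -> nat).
Variables (E : forall t n, {linear 'rV[k]_(hS t n) -> A}).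
Variables (cd : forall t n, {linear A -> 'rV[k]_(hS t n)}).
Hypothesis cdE : forall t n c, cd t n (E t n c) = c.
Hypothesis Ecd : forall t n x, E t n (cd t n x) = proj grA t n x.
Local Notation proj := (proj grA).

(* A matrix over A^c acts on row vectors from the right; its rows generate a
   right A-submodule of the free module of row vectors. The weights t are the
   degrees of the basis vectors. *)
Definition homogeneous_mx s N (w : 'cV[nat]_s) (t : 'cV[nat]_N)
    (D : 'M[A^c]_(s, N)) : Prop :=
  forall i j, shift_grading gr (t j 0) (w i 0) (D i j : A).

Definition rowspan s N (D : 'M[A^c]_(s, N)) : set 'rV[A^c]_N :=
  [set v | exists c, v = c *m D].

(** The dimension of the degree n part of the free module with basis in degrees t. Its coordinates
    are [EW] and [cdW], and [MW] is the matrix in degree n of the map given by a homogeneous D. *)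
Definition dimW N (t : 'cV[nat]_N) n : nat := (\sum_i hS (t i 0%R) n)%N.

Definition EW N (t : 'cV[nat]_N) n (c : 'rV[k]_(dimW t n)) : 'rV[A^c]_N :=
  \row_i (E (t i 0) n (submxrow c i) : A^c).

Definition cdW N (t : 'cV[nat]_N) n (v : 'rV[A^c]_N) : 'rV[k]_(dimW t n) :=
  \mxrow_i cd (t i 0) n (v 0 i : A).

Definition projW N (t : 'cV[nat]_N) n (v : 'rV[A^c]_N) : 'rV[A^c]_N :=
  \row_i (proj (t i 0) n (v 0 i : A) : A^c).

Lemma cdWE N t n c : cdW t n (@EW N t n c) = c.
Proof.
rewrite /cdW -[RHS]submxrowK; apply/eq_mxrowP => i.
by rewrite mxE cdE.
Qed.

Lemma EcdW N (t : 'cV[nat]_N) n v : EW (cdW t n v) = projW t n v.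
Proof. by apply/rowP => i; rewrite !mxE mxrowK Ecd. Qed.

Lemma EW_inj N (t : 'cV[nat]_N) n : injective (@EW N t n).
Proof. exact: can_inj (@cdWE N t n). Qed.

Lemma EWD N (t : 'cV[nat]_N) n : {morph @EW N t n : c d / c + d}.
Proof.
by move=> c d; apply/rowP => i; rewrite !mxE submxrowD linearD.
Qed.

Lemma EW0 N (t : 'cV[nat]_N) n : @EW N t n 0 = 0.
Proof. by apply/rowP => i; rewrite !mxE submxrow0 linear0. Qed.

Lemma EWZ N (t : 'cV[nat]_N) n a c :
  @EW N t n (a *: c) = (a%:A : A^c) *: @EW N t n c.
Proof.
apply/rowP => i; rewrite !mxE.
rewrite (_ : submxrow (a *: c) i = a *: submxrow c i); last first.
  by apply/rowP => j; rewrite !mxE.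
by rewrite linearZ; rewrite -[RHS]/(_ * (a%:A : A)) mulr_algr.
Qed.

Lemma projW_EW N (t : 'cV[nat]_N) n c : projW t n (@EW N t n c) = EW c.
Proof. by rewrite -EcdW cdWE. Qed.

Lemma projWD N (t : 'cV[nat]_N) n : {morph projW t n : u v / u + v}.
Proof. by move=> u v; apply/rowP => i; rewrite !mxE linearD. Qed.

Lemma mulmx_conv s N (c : 'rV[A^c]_s) (D : 'M[A^c]_(s, N)) j :
  (c *m D) 0 j = \sum_i (D i j : A) * (c 0 i : A) :> A.
Proof. by rewrite mxE. Qed.

Lemma projW_mul s N (w : 'cV[nat]_s) (t : 'cV[nat]_N) n D v :
  homogeneous_mx w t D -> projW t n (v *m D) = projW w n v *m D.
Proof.
move=> homD; apply/rowP => j; rewrite mulmx_conv mxE mulmx_conv linear_sum.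
apply: eq_bigr => i _ /=; rewrite mxE.
exact: proj_mull (homD i j).
Qed.

Definition block_of (a : A) w t n : 'M[k]_(hS w n, hS t n) :=
  lin1_mx (cd t n \o (a \*o E w n)).

Definition MW s N (w : 'cV[nat]_s) (t : 'cV[nat]_N) n (D : 'M[A^c]_(s, N)) :
    'M[k]_(dimW w n, dimW t n) :=
  \mxblock_(i, j) block_of (D i j : A) (w i 0) (t j 0) n.

Lemma mulMW s N (w : 'cV[nat]_s) (t : 'cV[nat]_N) n D c :
  c *m MW w t n D = cdW t n (EW c *m D).
Proof.
rewrite -{1}[c]submxrowK mul_mxrow_mxblock; apply/eq_mxrowP => j.
rewrite mulmx_conv linear_sum; apply: eq_bigr => i _.
by rewrite mul_rV_lin1 /= mxE.
Qed.

Lemma EW_mulMW s N (w : 'cV[nat]_s) (t : 'cV[nat]_N) n D c :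
  homogeneous_mx w t D -> EW (c *m MW w t n D) = EW c *m D.
Proof. by move=> homD; rewrite mulMW EcdW (projW_mul _ _ homD) projW_EW. Qed.

(** If a vector of degree n is a combination of the rows of D, it is also one whose coefficients are
    homogeneous of the right degrees: project the coefficients. *)
Lemma sub_MW s N (w : 'cV[nat]_s) (t : 'cV[nat]_N) n D u :
  homogeneous_mx w t D -> (u <= MW w t n D)%MS <-> rowspan D (EW u).
Proof.
move=> homD; split=> [/submxP[c ->]|[v uE]].
  by exists (EW c); rewrite EW_mulMW.
apply/submxP; exists (cdW w n v); apply: (@EW_inj _ t n).
by rewrite EW_mulMW // EcdW -(projW_mul _ _ homD) -uE projW_EW.
Qed.

Definition represents N (t : 'cV[nat]_N) n (U : 'M[k]_(dimW t n))
    (S : set 'rV[A^c]_N) : Prop :=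
  forall u, (u <= U)%MS <-> S (EW u).

(** The dimension of the degree n part of S. For submodules the default of [xget] is never reached,
    by [represents_exists]. *)
Definition piece_rank N (t : 'cV[nat]_N) n (S : set 'rV[A^c]_N) : nat :=
  \rank (xget 0 [set U : 'M[k]_(dimW t n) | represents U S]).

Lemma piece_rank_eq N (t : 'cV[nat]_N) n (S : set 'rV[A^c]_N) p
    (U : 'M[k]_(p, dimW t n)) :
  (forall u, (u <= U)%MS <-> S (EW u)) -> piece_rank t n S = \rank U.
Proof.
move=> US; rewrite /piece_rank; case: xgetP => [V _ VS|/(_ <<U>>%MS)]; last first.
  by case=> u; rewrite genmxE.
by apply/eqmx_rank/andP; split; apply/rV_subP => u; [move/VS/US | move/US/VS].
Qed.

Definition right_submodule N (S : set 'rV[A^c]_N) : Prop :=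
  S 0 /\ forall (a : A^c) u v, S u -> S v -> S (a *: u + v).

Lemma represents_exists N (t : 'cV[nat]_N) n (S : set 'rV[A^c]_N) :
  right_submodule S -> exists U, @represents N t n U S.
Proof.
move=> [S0 SD]; have [||U UP] := @subspace_matrix k _ [set u | S (@EW N t n u)].
- by rewrite /= EW0.
- by move=> c u v Su Sv /=; rewrite EWD EWZ; exact: SD.
by exists U => u; split=> [/UP|/UP].
Qed.

Lemma piece_rank_rowspan s N (w : 'cV[nat]_s) (t : 'cV[nat]_N) n D :
  homogeneous_mx w t D -> piece_rank t n (rowspan D) = \rank (MW w t n D).
Proof. by move=> homD; apply: piece_rank_eq => u; exact: sub_MW. Qed.

Lemma piece_rankT N (t : 'cV[nat]_N) n : piece_rank t n setT = dimW t n.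
Proof.
by rewrite (@piece_rank_eq _ _ _ _ _ 1%:M) ?mxrank1 // => u; rewrite submx1.
Qed.

Lemma piece_rank_le N (t : 'cV[nat]_N) n (S S' : set 'rV[A^c]_N) :
  right_submodule S -> right_submodule S' -> S `<=` S' ->
  (piece_rank t n S <= piece_rank t n S')%N.
Proof.
move=> /(represents_exists t n)[U US] /(represents_exists t n)[U' US'] SS'.
rewrite (piece_rank_eq US) (piece_rank_eq US'); apply/mxrankS/rV_subP => u.
by move=> /US/SS'/US'.
Qed.

Lemma piece_rank_lt N (t : 'cV[nat]_N) n (S S' : set 'rV[A^c]_N) u :
  right_submodule S -> right_submodule S' -> S `<=` S' ->
  S' u -> projW t n u = u -> ~ S u ->
  (piece_rank t n S < piece_rank t n S')%N.
Proof.
move=> /(represents_exists t n)[U US] /(represents_exists t n)[U' US'] SS'.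
move=> S'u pu nSu; rewrite (piece_rank_eq US) (piece_rank_eq US').
apply: rank_ltmx; rewrite ltmxE; apply/andP; split.
  by apply/rV_subP => v /US/SS'/US'.
apply/negP => /rV_subP /(_ (cdW t n u)) le.
have : (cdW t n u <= U')%MS by apply/US'; rewrite EcdW pu.
by move=> /le/US; rewrite EcdW pu.
Qed.

Definition ideal_rows (J : set A) : set 'rV[A^c]_1 := [set v | J (v 0 0 : A)].

Lemma ideal_rows_submodule J : right_ideal J -> right_submodule (ideal_rows J).
Proof.
move=> [J0 JD JM]; split=> [|a u v Ju Jv]; rewrite /ideal_rows /= !mxE //.
by apply: JD => //; exact: JM.
Qed.

Lemma piece_rank_shift J a n : right_ideal J ->
  piece_rank (const_mx a) n (ideal_rows J) =
  if (a <= n)%N then piece_rank 0 (n - a) (ideal_rows J) else 0%N.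
Proof.
move=> /ideal_rows_submodule subJ; set S := ideal_rows J in subJ *.
(* The two pieces have coordinates in row spaces of formally different lengths, so equal projections
   are turned into injective linear maps, one in each direction. *)
have compare (t t' : 'cV[nat]_1) m m' : projW t m =1 projW t' m' ->
    (piece_rank t m S <= piece_rank t' m' S)%N.
  move=> eqp; have [U US] := represents_exists t m subJ.
  have [U' US'] := represents_exists t' m' subJ.
  rewrite (piece_rank_eq US) (piece_rank_eq US').
  pose f0 (u : 'rV[k]_(dimW t m)) := cdW t' m' (EW u).
  have flin : linear f0.
    move=> c u v; apply: (@EW_inj _ t' m').
    by rewrite [RHS]EWD [in RHS]EWZ !EcdW -!eqp !projW_EW EWD EWZ.
  pose L := GRing.isLinear.Build k _ _ *:%R f0 flin.
  pose f : {linear 'rV[k]_(dimW t m) -> 'rV[k]_(dimW t' m')} := HB.pack f0 L.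
  have fE u : EW (u *m lin1_mx f) = EW u.
    by rewrite mul_rV_lin1 /= EcdW -eqp projW_EW.
  have ffree : row_free (lin1_mx f).
    rewrite -kermx_eq0; apply/eqP/row_matrixP => i; rewrite row0.
    apply: (@EW_inj _ t m); rewrite -fE EW0.
    have /sub_kermxP -> := row_sub i (kermx (lin1_mx f)).
    by rewrite EW0.
  rewrite -(mxrankMfree _ ffree); apply/mxrankS/rV_subP => u /submxP[c ->].
  by rewrite mulmxA; apply/US'; rewrite fE; apply/US; exact: submxMl.
case: ifP => [le_an|nle].
  apply/eqP; rewrite eqn_leq !compare // => v; apply/rowP => i;
    by rewrite !mxE /proj le_an subn0.
have [U US] := represents_exists (const_mx a) n subJ.
rewrite (piece_rank_eq US); apply/eqP; rewrite mxrank_eq0; apply/eqP.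
apply/row_matrixP => i; rewrite row0; apply: (@EW_inj _ (const_mx a) n).
rewrite -projW_EW EW0; apply/rowP => j; rewrite [LHS]mxE [RHS]mxE.
by rewrite /proj ifF // mxE.
Qed.

End GradedPieces.
(** * Quasi-coherent steps and linear quotients *)

Section QuasiCoherent.
Variables (k : fieldType) (A : algType k) (gr : nat -> set A).
Hypothesis grA : connected_grading gr.
Local Notation hcomp := (hcomp grA).

Lemma right_ideal_sum (I : set A) T (r : seq T) (P : pred T) (G : T -> A) :
  right_ideal I -> (forall i, P i -> I (G i)) -> I (\sum_(i <- r | P i) G i).
Proof. by move=> [I0 ID _] IG; elim/big_ind: _. Qed.

Lemma right_idealB (I : set A) x y : right_ideal I -> I x -> I y -> I (x - y).
Proof.
by move=> [_ ID IM] Ix Iy; apply: (ID) => //; rewrite -mulrN1; exact: IM.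
Qed.

Lemma right_ideal_one (I : set A) : right_ideal I -> I 1 -> I = setT.
Proof.
move=> [_ _ IM] I1; apply/seteqP; split=> // x _.
by rewrite -[x]mul1r; exact: IM.
Qed.

Lemma homogeneous_hcomp (I : set A) j x :
  right_ideal I -> homogeneous gr I -> I x -> I (hcomp j x).
Proof.
move=> idI homI /homI[n [a [aP ->]]]; rewrite linear_sum /=.
apply: right_ideal_sum => // i _; rewrite (hcomp_gr grA _ (aP i).2).
by case: eqP => _; [case: (aP i) | case: idI].
Qed.

Local Notation IAplus I := (mul_augmentation gr (M := A^c^o) I).

Lemma mul_augmentationD (I : set A) x y :
  IAplus I x -> IAplus I y -> IAplus I (x + y).
Proof.
move=> [n [s [a [sa ->]]]] [m [s' [a' [sa' ->]]]].
exists (n + m)%N,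
  (fun i => match fintype.split i with inl j => s j | inr j => s' j end),
  (fun i => match fintype.split i with inl j => a j | inr j => a' j end).
split=> [i|]; first by case: fintype.split => j.
rewrite big_split_ord /=; congr (_ + _); apply: eq_bigr => i _.
  by rewrite -[lshift m i]/(unsplit (inl i)) unsplitK.
by rewrite -[rshift n i]/(unsplit (inr i)) unsplitK.
Qed.

Lemma mul_augmentation0 (I : set A) : IAplus I 0.
Proof. by exists 0%N, (fun=> 0), (fun=> 0); split=> [[]//|]; rewrite big_ord0. Qed.

Lemma mul_augmentation_mul (I : set A) s a :
  I s -> hcomp 0 a = 0 -> IAplus I (s * a).
Proof.
move=> Is a0; exists 1%N, (fun=> s), (fun=> a).
split=> [_|]; last by rewrite big_ord1.
by split=> //; apply/(augmentation_idealE grA).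
Qed.

(** In high degree an element of I is a sum of components of generators times coefficients of
    positive degree. This bounds the set in [m0], whose supremum would otherwise default to 0. *)
Lemma generator_degrees_bounded (I : set A) :
  right_ideal I -> homogeneous gr I -> finitely_generated I ->
  exists N, forall j x, (N <= j)%N -> I x -> gr j x -> IAplus I x.
Proof.
move=> idI homI [n [g Ig]].
have Igi i : I (g i).
  rewrite Ig; exists (fun j => (j == i)%:R).
  rewrite (bigD1 i) //= eqxx mulr1 big1 ?addr0 // => j /negbTE ->.
  by rewrite mulr0.
have /choice[b bP] i : exists m, forall m', (m <= m')%N ->
    g i = \sum_(p < m') hcomp p (g i).
  exact: sum_hcomp.
pose N := \max_i b i; exists N => j x le_Nj Ix gx.
have <- : hcomp j x = x by rewrite (hcomp_gr grA _ gx) eqxx.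
have [a ->] : [set x | exists a, x = \sum_i g i * a i] x by rewrite -Ig.
rewrite linear_sum; elim/big_ind: _ => [||i _].
- exact: mul_augmentation0.
- by move=> y z; exact: mul_augmentationD.
have gE : g i = \sum_(p < N) hcomp p (g i) by apply/bP/leq_bigmax.
rewrite {1}gE mulr_suml linear_sum /=; elim/big_ind: _ => [||p _].
- exact: mul_augmentation0.
- by move=> y z; exact: mul_augmentationD.
rewrite (hcomp_mull grA _ _ (gr_hcomp grA p _)) ifT; last by have := ltn_ord p; lia.
apply: mul_augmentation_mul; first exact: homogeneous_hcomp.
by rewrite (hcomp_gr grA _ (gr_hcomp grA _ _)) ifF //; have := ltn_ord p; lia.
Qed.

Lemma m0_ge (I : set A) j x :
  right_ideal I -> homogeneous gr I -> finitely_generated I ->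
  I x -> gr j x -> ~ IAplus I x -> (j <= m0 gr I)%N.
Proof.
move=> idI homI fgI Ix gx nx; rewrite -leEnat /m0.
apply: ge_supremum_Nmem; last by exists x.
apply: nat_supremums_neq0.
have [N NP] := generator_degrees_bounded idI homI fgI.
exists N => i [y [Iy gy ny]]; rewrite leEnat leqNgt; apply/negP => lt_Ni.
by apply: ny; apply: NP gy => //; exact: ltnW.
Qed.

Variables (F : set (set A)) (d : nat).
Hypothesis cohF : quasi_coherent_family gr F.
Hypothesis degF : family_of_degree gr F d.

Lemma family_right_ideal I : F I -> right_ideal I.
Proof. by case: cohF => idF _ _ /idF[]. Qed.

Lemma family_zero : F [set 0].
Proof. by case: cohF. Qed.

(* The witness g is the degree t part of a preimage of the class of 1 under
   the isomorphism from I / J1 to (A / J2)[-t]. *)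
Lemma quasi_coherent_step I : F I -> I <> [set 0] ->
  exists J1 J2 g t,
    [/\ F J1 /\ F J2, J1 `<=` I, ~ J2 1, I g /\ gr t g &
        [/\ (t <= d)%N, ~ I 1 -> (0 < t)%N,
            forall x, I x -> exists a, J1 (x - g * a) &
            forall a, J1 (g * a) <-> J2 a]].
Proof.
move=> FI In0.
have [idF _ stepF] := cohF; have [idI homI fgI] := idF _ FI.
have [J1 [J2 [FJ1 FJ2 [J1I J1nI] _ [t [f [_ fD fM [fT fS fg]]]]]]] :=
  stepF _ FI In0.
have [idJ1 homJ1 _] := idF _ FJ1; have [idJ2 homJ2 _] := idF _ FJ2.
have [I0 ID IM] := idI; have [J20 J2D J2M] := idJ2.
have nJ21 : ~ J2 1.
  move=> /(right_ideal_one idJ2) J2T; apply: J1nI; apply/seteqP; split=> // x Ix.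
  by apply/fT => //; rewrite J2T.
have congS x y z : J2 (x - y) -> J2 (y - z) -> J2 (x - z).
  by move=> xy yz; rewrite -(subrKA y); exact: J2D.
have congN x y : J2 (x - y) -> J2 (y - x).
  by move=> xy; rewrite -opprB -mulrN1; exact: J2M.
have f0 : J2 (f 0) by apply/fT => //; case: idJ1.
have fsum n (G : 'I_n -> A) : (forall i, I (G i)) ->
    J2 (f (\sum_i G i) - \sum_i f (G i)).
  elim: n G => [|n IH] G IG; first by rewrite !big_ord0 subr0.
  rewrite !big_ord_recr /=; apply: (congS _ _ _ (fD _ _ _ (IG _))).
    by apply: right_ideal_sum.
  by rewrite opprD addrACA subrr addr0; exact: IH.
have [x0 Ix0 fx0] := fS 1 Logic.I.
pose g := hcomp t x0.
have Ig : I g by exact: homogeneous_hcomp.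
have gg : gr t g by exact: gr_hcomp.
(* Modulo J2, f sends the component of x0 of degree i to some y i of degree i - t, and the y i sum
   to 1. As J2 is homogeneous, the degree 0 part of this congruence is y t = 1, and y t represents f
   g. *)
have fg1 : J2 (1 - f g).
  have [n x0E] := sum_hcomp grA x0.
  pose m := maxn n t.+1.
  have /choice[y yP] (i : nat) : exists y,
      shift_grading gr t i y /\ J2 (f (hcomp i x0) - y).
    have [y [_ gy fy]] :=
      fg i _ (homogeneous_hcomp i idI homI Ix0) (gr_hcomp grA i x0).
    by exists y.
  have ytE : y t = hcomp 0 (\sum_(i < m) y i).
    have lt_tm : (t < m)%N by rewrite /m; lia.
    rewrite linear_sum /= (bigD1 (Ordinal lt_tm)) //= big1 => [|i ne].
      have [+ _] := yP t; rewrite /shift_grading leqnn subnn => gy.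
      by rewrite (hcomp_gr grA _ gy) addr0.
    have [+ _] := yP i; rewrite /shift_grading.
    case: leqP => [le_ti gy|_ ->]; last by rewrite linear0.
    rewrite (hcomp_gr grA _ gy) ifF //; apply: contraNF ne => /eqP eq0.
    by apply/eqP/val_inj => /=; lia.
  have sum1 : J2 (1 - \sum_(i < m) y i).
    apply: (congS _ _ _ fx0); rewrite [x0 in f x0](x0E m) ?leq_maxl //.
    apply: (congS _ _ _ (fsum _ _ _)); first by move=> i; exact: homogeneous_hcomp.
    by rewrite -sumrB; apply: right_ideal_sum => // i _; case: (yP i).
  have := homogeneous_hcomp 0 idJ2 homJ2 sum1.
  rewrite linearB /= -ytE (hcomp_gr grA _ (gr_one grA)) eqxx => y1.
  by apply: (congS _ _ _ y1); apply: (congN); case: (yP t).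
have f1 x : J2 (x - f g * x) by rewrite -[X in X - _]mul1r -mulrBl; exact: J2M.
have J1g a : J1 (g * a) <-> J2 a.
  rewrite (fT _ (IM _ a Ig)); split=> Ja.
    rewrite -[a](subrK (f g * a)); apply: (J2D) => //.
    rewrite -[f g * a](subrK (f (g * a))); apply: (J2D) => //.
    by apply: (congN); exact: fM.
  rewrite -[f (g * a)](subrK (f g * a)); apply: (J2D); first exact: fM.
  rewrite -[f g * a](subrK a); apply: (J2D) => //.
  exact/congN/f1.
exists J1, J2, g, t; split=> //; split=> //.
(* g is a minimal generator: if it were in I A_+, then f g, congruent to 1, would lie in A_+ modulo
   J2, and taking degree 0 parts would put 1 in J2. *)
- apply: leq_trans (degF FI); apply: (m0_ge idI homI fgI Ig gg).
  move=> [n [s [a [sa gE]]]]; apply: nJ21.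
  have gE' : g = \sum_(i < n) (s i : A) * a i by [].
  pose b := \sum_(i < n) f (s i) * a i.
  have b0 : hcomp 0 b = 0.
    rewrite linear_sum big1 //= => i _.
    have [_ /(augmentation_idealE grA) ai0] := sa i.
    have [m /(_ m (leqnn m)) fsE] := sum_hcomp grA (f (s i)).
    rewrite fsE mulr_suml linear_sum big1 //= => p _.
    rewrite (hcomp_mull grA _ _ (gr_hcomp grA p _)) leqn0.
    by case: eqP => // ->; rewrite ai0 mulr0.
  have fb : J2 (f g - b).
    rewrite {1}gE'; apply: (congS _ _ _ (fsum _ _ _)).
      by move=> i; apply: (IM); case: (sa i).
    by rewrite -sumrB; apply: right_ideal_sum => // i _; apply: (fM); case: (sa i).
  have := homogeneous_hcomp 0 idJ2 homJ2 (congS _ _ _ fg1 fb).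
  by rewrite linearB /= b0 subr0 (hcomp_gr grA _ (gr_one grA)).
- move=> nI1; rewrite lt0n; apply/eqP => t0; move: gg; rewrite t0.
  move=> /(gr0_scalar grA)[c gE]; have [c0|cN0] := eqVneq c 0.
    apply: nJ21; apply/J1g; rewrite gE c0 scale0r mul0r.
    by case: idJ1.
  apply: nI1; have := IM _ (c^-1)%:A Ig.
  by rewrite gE mulr_algr scalerA mulVf // scale1r.
(* As g corresponds to the class of 1, g * f x and x have the same image, so their difference lies
   in the kernel J1. *)
- move=> x Ix; exists (f x).
  have Igx : I (g * f x) by exact: IM.
  apply/fT; first exact: right_idealB.
  have : J2 (f (x - g * f x + g * f x) - (f (x - g * f x) + f (g * f x))).
    by apply: fD => //; exact: right_idealB.
  rewrite subrK => fx; rewrite -[f (x - _)](addrK (f (g * f x))).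
  apply: (congS _ _ _ (congN _ _ fx)); apply: (congS _ _ _ (f1 _)).
  exact/congN/fM.
Qed.

End QuasiCoherent.
Lemma col_0mx (R : Type) m n (C : 'M[R]_(0, n)) (D : 'M[R]_(m, n)) :
  col_mx C D = D.
Proof.
apply/matrixP => i j; rewrite -[RHS](col_mxEd C D); congr (col_mx _ _ _ _).
exact: val_inj.
Qed.

Lemma col_mxA1 (R : Type) m u n (g : 'rV[R]_n) (C : 'M[R]_(m, n))
    (D : 'M[R]_(u, n)) :
  col_mx (col_mx g C) D = col_mx g (col_mx C D).
Proof. by rewrite [RHS]col_mxA castmx_id. Qed.

Section LinearQuotients.
Variables (k : fieldType) (A : algType k) (gr : nat -> set A).
Variable F : set (set A).

Definition colon s N (g : 'rV[A^c]_N) (D : 'M[A^c]_(s, N)) : set A :=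
  [set a : A | exists c, (a : A^c) *: g = c *m D].

(* The generators are listed from the last to the first. *)
Fixpoint linear_quotients s N : 'M[A^c]_(s, N) -> Prop :=
  match s with
  | 0 => fun=> True
  | s'.+1 => fun D : 'M[A^c]_(1 + s', N) =>
      [/\ F (colon (usubmx D) (dsubmx D)), ~ colon (usubmx D) (dsubmx D) 1 &
          linear_quotients (dsubmx D)]
  end.

Lemma linear_quotients_col s N (g : 'rV[A^c]_N) (D : 'M[A^c]_(s, N)) :
  linear_quotients (col_mx g D) <->
  [/\ F (colon g D), ~ colon g D 1 & linear_quotients D].
Proof. by rewrite /= col_mxKu col_mxKd. Qed.

Lemma homogeneous_col r s N (w0 : 'cV[nat]_r) (w : 'cV[nat]_s) (t : 'cV[nat]_N)
    (g : 'M[A^c]_(r, N)) (D : 'M[A^c]_(s, N)) :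
  homogeneous_mx gr (col_mx w0 w) t (col_mx g D) <->
  homogeneous_mx gr w0 t g /\ homogeneous_mx gr w t D.
Proof.
split=> [hom|[homg homD] i j].
  split=> i j; first by have := hom (lshift s i) j; rewrite !col_mxEu.
  by have := hom (rshift r i) j; rewrite !col_mxEd.
by case: (split_ordP i) => i' ->; rewrite ?col_mxEu ?col_mxEd.
Qed.

Lemma homogeneous_row s N N' (w : 'cV[nat]_s) (t : 'cV[nat]_N) (t' : 'cV[nat]_N')
    (D : 'M[A^c]_(s, N)) (D' : 'M[A^c]_(s, N')) :
  homogeneous_mx gr w t D -> homogeneous_mx gr w t' D' ->
  homogeneous_mx gr w (col_mx t t') (row_mx D D').
Proof.
move=> homD homD' i j.
by case: (split_ordP j) => j' ->; rewrite ?col_mxEu ?col_mxEd ?row_mxEl ?row_mxEr.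
Qed.

Lemma mul_scalar_row N (v : 'rV[A^c]_1) (g : 'rV[A^c]_N) : v *m g = v 0 0 *: g.
Proof. by rewrite {1}[v]mx11_scalar mul_scalar_mx. Qed.

Lemma linear_quotients_stack m u N N' (C : 'M[A^c]_(m, N)) (X : 'M[A^c]_(m, N'))
    (Y : 'M[A^c]_(u, N')) :
  linear_quotients C -> linear_quotients Y ->
  (forall v, v *m C = 0 -> rowspan Y (v *m X)) ->
  linear_quotients (col_mx (row_mx C X) (row_mx 0 Y)).
Proof.
move=> + lqY.
have colon_stack m' (c : 'rV[A^c]_N) (C' : 'M[A^c]_(m', N)) x X' :
    (forall v, v *m col_mx c C' = 0 -> rowspan Y (v *m col_mx x X')) ->
    colon (row_mx c x) (col_mx (row_mx C' X') (row_mx 0 Y)) = colon c C'.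
  move=> rel; apply/seteqP; split=> a [v vE].
    exists (lsubmx v); move: vE; rewrite -{1}[v]hsubmxK mul_row_col !mul_mx_row.
    by rewrite mulmx0 scale_row_mx add_row_mx addr0 => /eq_row_mx[].
  have [|w wE] := rel (row_mx a%:M (- v)).
    by rewrite mul_row_col mul_scalar_mx mulNmx vE subrr.
  exists (row_mx v w); rewrite mul_row_col !mul_mx_row mulmx0 scale_row_mx.
  rewrite add_row_mx addr0 vE -wE mul_row_col mul_scalar_mx mulNmx.
  by rewrite addrC subrK.
elim: m C X => [|m IH].
  move=> C X lqC relX.
  rewrite col_0mx; elim: u Y lqY {relX colon_stack} => // u IH.
  rewrite -[u.+1]/(1 + u)%N => Y; rewrite -[Y]vsubmxK.
  move=> /linear_quotients_col[FY nY lqY].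
  have -> : row_mx 0 (col_mx (usubmx Y) (dsubmx Y)) =
      col_mx (row_mx 0 (usubmx Y)) (row_mx 0 (dsubmx Y)) :> 'M[A^c]_(1 + u, N + N').
    by rewrite -[X in row_mx X _]col_mx0 -block_mxEh block_mxEv.
  have cE : colon (row_mx (0 : 'rV_N) (usubmx Y)) (row_mx 0 (dsubmx Y)) =
      colon (usubmx Y) (dsubmx Y).
    apply/seteqP; split=> a [c cE]; exists c; move: cE.
      by rewrite mul_mx_row scale_row_mx => /eq_row_mx[].
    by rewrite mul_mx_row scale_row_mx mulmx0 scaler0 => ->.
  by apply/linear_quotients_col; rewrite cE; split=> //; exact: IH.
rewrite -[m.+1]/(1 + m)%N => C X; rewrite -[C]vsubmxK -[X]vsubmxK.
move: (usubmx C) (dsubmx C) (usubmx X) (dsubmx X) => {C X} c C' x X'.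
move=> /linear_quotients_col[Fc nc lqC'] rel.
have -> : row_mx (col_mx c C') (col_mx x X') =
    col_mx (row_mx c x) (row_mx C' X') :> 'M[A^c]_(1 + m, N + N').
  by rewrite -block_mxEh block_mxEv.
rewrite col_mxA1; apply/linear_quotients_col; rewrite colon_stack //; split=> //.
apply: IH => // v vC; have := rel (row_mx 0 v).
by rewrite !mul_row_col !mul0mx !add0r; exact.
Qed.

End LinearQuotients.

(** * Generators and syzygies with colon ideals in F *)

Section Flags.
Variables (k : fieldType) (A : algType k) (gr : nat -> set A).
Hypothesis grA : connected_grading gr.
Variables (hS : nat -> nat -> nat).
Variables (E : forall t n, {linear 'rV[k]_(hS t n) -> A}).
Variables (cd : forall t n, {linear A -> 'rV[k]_(hS t n)}).
Hypothesis cdE : forall t n c, cd t n (E t n c) = c.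
Hypothesis Ecd : forall t n x, E t n (cd t n x) = proj grA t n x.
Variables (F : set (set A)) (d : nat).
Hypothesis cohF : quasi_coherent_family gr F.
Hypothesis degF : family_of_degree gr F d.

Definition flag_of (I : set A) s (w : 'cV[nat]_s) (C : 'M[A^c]_(s, 1)) : Prop :=
  [/\ linear_quotients F C, homogeneous_mx gr w 0 C &
      ideal_rows I = rowspan C].

Local Notation piece_rank := (piece_rank E).

(** The dimension of I in degrees at most d, which serves both as the induction measure and as the
    bound on the number of generators. *)
Definition low_rank (I : set A) : nat :=
  (\sum_(j < d.+1) piece_rank (0%R : 'cV_1) j (ideal_rows I))%N.

Lemma low_rank_lt I J g t : right_ideal I -> right_ideal J -> J `<=` I ->
  I g -> gr t g -> ~ J g -> (t <= d)%N -> (low_rank J < low_rank I)%N.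
Proof.
move=> idI idJ JI Ig gg nJg le_td.
have subI := ideal_rows_submodule idI; have subJ := ideal_rows_submodule idJ.
have lt_t : (t < d.+1)%N by [].
rewrite /low_rank (bigD1 (Ordinal lt_t)) //= [ltnRHS](bigD1 (Ordinal lt_t)) //=.
rewrite -addSn leq_add //; last first.
  by apply: leq_sum => i _; apply: piece_rank_le => // v; exact: JI.
apply: (piece_rank_lt Ecd (u := (g%:M : 'rV[A^c]_1))) => //.
- by move=> v; exact: JI.
- by rewrite /ideal_rows /= !mxE.
- apply/rowP => j; rewrite !mxE ord1 /= /proj leq0n subn0.
  by rewrite (hcomp_gr grA _ gg) eqxx.
- by rewrite /ideal_rows /= !mxE.
Qed.

(** The quasi-coherent step is iterated on J1, which stays proper inside I; J2 is recorded as the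
    colon ideal of the new generator. Each step removes g, of degree at most d, so [low_rank]
    drops. *)
Lemma flag_exists I : F I -> ~ I 1 -> exists s (w : 'cV[nat]_s) C,
  [/\ flag_of I w C, forall i, (0 < w i 0%R <= d)%N & (s <= low_rank I)%N].
Proof.
have [n] := ubnP (low_rank I); elim: n I => // n IH I lt_In FI nI1.
have idI := family_right_ideal cohF FI.
have [I0|In0] := pselect (I = [set 0]).
  exists 0%N, 0, 0; split=> [|[]|] //; split=> // [[]//|].
  apply/seteqP; split=> v /=; rewrite /ideal_rows I0 /=.
    by move=> v0; exists 0; rewrite mul0mx; apply/rowP => j; rewrite ord1 v0 mxE.
  by case=> c ->; rewrite mulmx0 mxE.
have [J1 [J2 [g [t [[FJ1 FJ2] J1I nJ2 [Ig gg] [le_td t_gt0 decI colonE]]]]]] :=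
  quasi_coherent_step grA cohF degF FI In0.
have idJ1 := family_right_ideal cohF FJ1.
have [I0 ID IM] := idI.
have lt_J1 : (low_rank J1 < low_rank I)%N.
  apply: low_rank_lt Ig gg _ le_td => //.
  by rewrite -[g]mulr1 => /colonE.
have [||s [w [C [[lqC homC spanC] wP le_s]]]] := IH J1 _ FJ1.
- by apply: leq_trans lt_J1 _; rewrite -ltnS.
- by move=> /J1I.
have colE : colon g%:M C = J2.
  apply/seteqP; split=> a.
    move=> [c cE]; apply/colonE; have : ideal_rows J1 ((a : A^c) *: g%:M).
      by rewrite spanC; exists c.
    by rewrite /ideal_rows /= !mxE.
  move=> /colonE Ja; have : ideal_rows J1 ((a : A^c) *: g%:M).
    by rewrite /ideal_rows /= !mxE.
  by rewrite spanC.
exists (1 + s)%N, (col_mx (const_mx t) w), (col_mx g%:M C); split.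
- split.
  + by apply/linear_quotients_col; rewrite colE.
  + apply/homogeneous_col; split=> // i j; rewrite !ord1 !mxE /=.
    by rewrite /shift_grading leq0n subn0.
  + apply/seteqP; split=> v.
      move=> /decI[a Ja].
      have : ideal_rows J1 (v - (a : A^c) *: g%:M).
        by rewrite /ideal_rows /= !mxE.
      rewrite spanC => -[c vE]; exists (row_mx a%:M c).
      by rewrite mul_row_col -vE mul_scalar_mx addrC subrK.
    move=> [c ->]; rewrite -[c]hsubmxK mul_row_col /ideal_rows /= mxE; apply: ID.
      by rewrite mulmx_conv big_ord1 mxE; exact: IM.
    apply: J1I; have : rowspan C (rsubmx c *m C) by exists (rsubmx c).
    by rewrite -spanC.
- move=> i; case: (split_ordP i) => j ->; rewrite ?col_mxEu ?col_mxEd ?mxE //.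
  by rewrite le_td t_gt0.
- by apply: leq_ltn_trans le_s _.
Qed.

Lemma low_rank_le I : right_ideal I -> (low_rank I <= low_rank setT)%N.
Proof.
move=> idI; apply: leq_sum => i _; apply: piece_rank_le => //.
exact: ideal_rows_submodule.
Qed.

(** Adding a row g to D adds one relation for each generator C_i of the colon ideal of g, namely a
    lift C_i g = B_i D. The generators of a proper ideal of F have degrees between 1 and d, whence
    the shift of the degree bounds, and each colon ideal needs at most [low_rank setT] of them. *)
Lemma syzygies s N (D : 'M[A^c]_(s, N)) (w : 'cV[nat]_s) (t : 'cV[nat]_N) lo hi :
  linear_quotients F D -> homogeneous_mx gr w t D ->
  (forall i, (lo <= w i 0%R <= hi)%N) ->
  exists u (w' : 'cV[nat]_u) (D' : 'M[A^c]_(u, s)),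
    [/\ linear_quotients F D', homogeneous_mx gr w' w D',
        forall i, (lo < w' i 0%R <= hi + d)%N, (u <= s * low_rank setT)%N &
        forall v, v *m D = 0 <-> rowspan D' v].
Proof.
elim: s D w => [|s IH].
  move=> D w _ _ _; exists 0%N, 0, 0; split=> [|[]|[]||v] //.
  split=> [_|[c ->]]; last by rewrite mulmx0 mul0mx.
  by exists 0; apply/rowP => -[].
rewrite -[s.+1]/(1 + s)%N => D w; rewrite -[D]vsubmxK -[w]vsubmxK.
move: (usubmx D) (dsubmx D) (usubmx w) (dsubmx w) => {D w} g D w0 w.
move=> /linear_quotients_col[FJ nJ lqD] /homogeneous_col[homg homD] wP.
have w0P : (lo <= w0 0%R 0%R <= hi)%N by have := wP (lshift s 0); rewrite col_mxEu.
have [|u [w' [D' [lqD' homD' w'P le_u syzD]]]] := IH _ _ lqD homD.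
  by move=> i; have := wP (rshift 1 i); rewrite col_mxEd.
have [m [wJ [C [[lqC homC spanC] wJP le_m]]]] := flag_exists FJ nJ.
have C_colon i : colon g D (C i 0).
  have : ideal_rows (colon g D) (row i C).
    by rewrite spanC; exists (delta_mx 0 i); rewrite rowE.
  by rewrite /ideal_rows /= mxE.
have /choice[b bP] i : exists b : 'rV[A^c]_s, C i 0 *: g = b *m D /\
    forall j, shift_grading gr (w j 0) (w0 0%R 0%R + wJ i 0%R)%N (b 0 j : A).
  (* The coefficients of this lift need not be homogeneous; their components of degree n satisfy the
     same equation since C, g and D are homogeneous. *)
  have [b bE] := C_colon i; set n := (w0 0%R 0%R + wJ i 0%R)%N.
  exists (projW grA w n b); split; last first.
    by move=> j; rewrite mxE; exact: shift_grading_proj.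
  rewrite -(projW_mul grA _ _ homD) -bE -mul_scalar_mx (projW_mul grA _ _ homg).
  congr (_ *m _); apply/rowP => j; rewrite !ord1 !mxE /= proj_id //.
  have := homC i 0; rewrite !mxE /shift_grading leq0n subn0 => gC.
  by rewrite leq_addr addKn.
pose B := \matrix_i b i.
have CB : C *m g = B *m D.
  apply/row_matrixP => i; rewrite !row_mul rowK -(bP i).1.
  by rewrite mul_scalar_row mxE.
exists (m + u)%N, (col_mx (\col_i (w0 0%R 0%R + wJ i 0%R)%N) w'),
  (col_mx (row_mx C (- B)) (row_mx 0 D')); split.
- apply: linear_quotients_stack => // v vC; apply/syzD.
  by rewrite mulmxN mulNmx -mulmxA -CB mulmxA vC mul0mx oppr0.
- apply/homogeneous_col; split; apply: homogeneous_row => //.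
  + move=> i j; rewrite !ord1 !mxE /shift_grading leq_addr addKn.
    by have := homC i 0; rewrite !mxE /shift_grading leq0n subn0.
  + move=> i j; rewrite !mxE; have [_ /(_ j)] := bP i.
    rewrite /shift_grading; case: ifP => _; first exact: grN.
    by move=> /= ->; rewrite oppr0.
  + move=> i j; rewrite mxE /shift_grading.
    by case: ifP => // _; exact: gr_zero.
- move=> i; case: (split_ordP i) => j ->; rewrite ?col_mxEu ?col_mxEd ?mxE //.
  by have := wJP j; lia.
- rewrite mulnDl mul1n leq_add //; apply: leq_trans le_m _.
  exact/low_rank_le/(family_right_ideal cohF).
move=> v; split.
  rewrite -[v]hsubmxK mul_row_col => vD.
  have : ideal_rows (colon g D) (lsubmx v).
    exists (- rsubmx v); rewrite -mul_scalar_row mulNmx.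
    by apply/eqP; rewrite -subr_eq0 opprK vD.
  rewrite spanC => -[c cE]; rewrite cE.
  have [|e eE] := (syzD (rsubmx v + c *m B)).1.
    by rewrite mulmxDl -mulmxA -CB mulmxA -cE addrC.
  exists (row_mx c e); rewrite mul_row_col !mul_mx_row add_row_mx mulmx0 addr0 -eE.
  by rewrite mulmxN addrC addrK.
move=> [c ->]; rewrite -[c]hsubmxK !mul_row_col !mul_mx_row add_row_mx mulmx0 addr0.
rewrite mul_row_col mulmxDl mulmxN mulNmx -!mulmxA CB addrA subrr add0r.
have -> : D' *m D = 0.
  apply/row_matrixP => i; rewrite row_mul row0; apply/syzD.
  by exists (delta_mx 0 i); rewrite rowE.
by rewrite mulmx0.
Qed.

End Flags.
(** * Hilbert functions *)

Section HilbertFunctions.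
Variables (k : fieldType) (A : algType k) (gr : nat -> set A).
Hypothesis grA : connected_grading gr.
Variables (hS : nat -> nat -> nat).
Variables (E : forall t n, {linear 'rV[k]_(hS t n) -> A}).
Variables (cd : forall t n, {linear A -> 'rV[k]_(hS t n)}).
Hypothesis cdE : forall t n c, cd t n (E t n c) = c.
Hypothesis Ecd : forall t n x, E t n (cd t n x) = proj grA t n x.
Local Notation piece_rank := (piece_rank E).
Local Notation MW := (MW E cd).

Definition hilb (I : set A) (n : nat) : nat :=
  piece_rank (0%R : 'cV_1) n (ideal_rows I).

Definition shift_fun (V : nmodType) (a : nat) (h : nat -> V) (n : nat) : V :=
  if (a <= n)%N then h (n - a)%N else 0%R.

Lemma right_idealT : right_ideal [set: A].
Proof. by split. Qed.

Lemma piece_rank_hilb I a n : right_ideal I ->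
  piece_rank (const_mx a : 'cV_1) n (ideal_rows I) = shift_fun a (hilb I) n.
Proof. exact: (piece_rank_shift cdE Ecd). Qed.

Lemma hS_hilb a n : hS a n = shift_fun a (hilb setT) n.
Proof.
rewrite -(piece_rank_hilb a n right_idealT).
have -> : ideal_rows [set: A] = setT by [].
by rewrite piece_rankT /dimW big_ord1 mxE.
Qed.

(** The dimension count in degree n for the isomorphism between the span of g and D modulo the span
    of D and the shifted quotient A / (D : g), written additively to stay in nat. *)
Lemma rank_MW_col s N (g : 'rV[A^c]_N) (D : 'M[A^c]_(s, N)) (w0 : 'cV[nat]_1)
    (w : 'cV[nat]_s) (t : 'cV[nat]_N) n :
  homogeneous_mx gr w0 t g -> homogeneous_mx gr w t D ->
  right_ideal (colon g D) ->
  (\rank (MW (col_mx w0 w) t n (col_mx g D)) +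
     piece_rank w0 n (ideal_rows (colon g D)) =
   dimW hS w0 n + \rank (MW w t n D))%N.
Proof.
move=> homg homD idJ.
set M := MW w0 t n g; set M' := MW w t n D.
have eqM : (MW (col_mx w0 w) t n (col_mx g D) :=: M + M')%MS.
  have homC : homogeneous_mx gr (col_mx w0 w) t (col_mx g D).
    exact/homogeneous_col.
  apply/eqmxP/andP; split; last first.
    rewrite addsmx_sub; apply/andP; split; apply/rV_subP => u.
      move=> /(sub_MW cdE Ecd _ homg)[c uE]; apply/(sub_MW cdE Ecd _ homC).
      by exists (row_mx c 0); rewrite mul_row_col mul0mx addr0.
    move=> /(sub_MW cdE Ecd _ homD)[c uE]; apply/(sub_MW cdE Ecd _ homC).
    by exists (row_mx 0 c); rewrite mul_row_col mul0mx add0r.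
  apply/rV_subP => u /(sub_MW cdE Ecd _ homC)[c uE].
  have -> : u = cdW cd t n (lsubmx c *m g) + cdW cd t n (rsubmx c *m D).
    apply: (EW_inj cdE); rewrite EWD !(EcdW Ecd) -projWD -mul_row_col hsubmxK.
    by rewrite -uE (projW_EW cdE Ecd).
  apply: addmx_sub_adds.
    apply/(sub_MW cdE Ecd _ homg); exists (projW grA w0 n (lsubmx c)).
    by rewrite (EcdW Ecd) (projW_mul grA _ _ homg).
  apply/(sub_MW cdE Ecd _ homD); exists (projW grA w n (rsubmx c)).
  by rewrite (EcdW Ecd) (projW_mul grA _ _ homD).
have [U US] := represents_exists E w0 n (ideal_rows_submodule idJ).
rewrite (piece_rank_eq US) eqM.
(* K kills exactly the row space of M', so M *m K is the map a |-> a g modulo the span of D, and its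
   kernel is the colon ideal in degree n. *)
pose K := cokermx M'.
have eqU : (U :=: kermx (M *m K))%MS.
  have kerP (u : 'rV_(dimW hS w0 n)) : (u <= U)%MS <-> (u <= kermx (M *m K))%MS.
    rewrite US sub_kermx mulmxA -submxE.
    have -> : (u *m M <= M')%MS <-> rowspan D (EW E u *m g).
      by rewrite -(EW_mulMW cdE Ecd _ homg); exact: (sub_MW cdE Ecd).
    by rewrite /ideal_rows /colon /rowspan /= mul_scalar_row.
  apply/eqmxP/andP; split; apply/rV_subP => u.
    by move/(kerP u).1.
  by move/(kerP u).2.
have <- := mxrank_mul_ker (M + M')%MS K.
have -> : ((M + M')%MS :&: kermx K :=: M')%MS.
  apply/eqmxP/andP; split; last first.
    by rewrite sub_capmx addsmxSr sub_kermx mulmx_coker eqxx.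
  by apply/rV_subP => u; rewrite sub_capmx sub_kermx -submxE => /andP[].
have -> : ((M + M')%MS *m K :=: M *m K)%MS.
  apply: eqmx_trans (addsmxMr _ _ _) _.
  by rewrite mulmx_coker; exact: addsmx0.
rewrite eqU mxrank_ker addnAC; congr (_ + _)%N.
by rewrite subnKC // rank_leq_row.
Qed.

Lemma rank_linear_quotients (F : set (set A)) s N (D : 'M[A^c]_(s, N)) :
  (forall J, F J -> right_ideal J) -> linear_quotients F D ->
  exists J : 'I_s -> set A, (forall i, F (J i) /\ ~ J i 1) /\
    forall (w : 'cV[nat]_s) (t : 'cV[nat]_N) n, homogeneous_mx gr w t D ->
      (\rank (MW w t n D) + \sum_i shift_fun (w i 0%R) (hilb (J i)) n =
       \sum_i shift_fun (w i 0%R) (hilb setT) n)%N.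
Proof.
move=> idF; elim: s D => [|s IH].
  move=> D _; exists (fun=> set0); split=> [[]//|w t n homD].
  rewrite !big_ord0 addn0; apply/eqP; rewrite -leqn0.
  by apply: leq_trans (rank_leq_row _) _; rewrite /dimW big_ord0.
rewrite -[s.+1]/(1 + s)%N => D; rewrite -[D]vsubmxK.
move: (usubmx D) (dsubmx D) => {D} g D /linear_quotients_col[FJ nJ lqD].
have [J [JP rkD]] := IH _ lqD.
exists (fun i => match fintype.split i with inl _ => colon g D | inr j => J j end).
split=> [i|w t n]; first by case: fintype.split => // j.
rewrite -[w]vsubmxK; move: (usubmx w) (dsubmx w) => {w} w0 w.
move=> /homogeneous_col[homg homD].
have := rank_MW_col n homg homD (idF _ FJ); have := rkD _ _ n homD.
have w0E : w0 = const_mx (w0 0 0) by apply/colP => i; rewrite ord1 mxE.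
have -> : piece_rank w0 n (ideal_rows (colon g D)) =
    shift_fun (w0 0 0) (hilb (colon g D)) n.
  by rewrite [in LHS]w0E (piece_rank_hilb _ _ (idF _ FJ)).
have -> : dimW hS w0 n = shift_fun (w0 0 0) (hilb setT) n.
  by rewrite /dimW big_ord1 hS_hilb.
move: (\rank (MW w t n D)) (\rank (MW (col_mx w0 w) t n _)) => r' r e1 e2.
rewrite !big_split_ord !big_ord1 /= !col_mxEu.
rewrite -[lshift s 0]/(unsplit (inl 0)) unsplitK /=.
under [X in (_ + (_ + X) = _)%N]eq_bigr => i _ do
  rewrite col_mxEd -[rshift 1 i]/(unsplit (inr i)) unsplitK.
under [X in (_ = _ + X)%N]eq_bigr => i _ do rewrite col_mxEd.
by rewrite addnA -e1 addnA; congr addn; exact: e2.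
Qed.

(** The right-hand side depends on w and n only: this is the constant rank sum required by
    [finite_rank_functions]. *)
Lemma rank_exact s u N (C : 'M[A^c]_(s, N)) (w : 'cV[nat]_s) (D : 'M[A^c]_(u, s))
    (w' : 'cV[nat]_u) (t : 'cV[nat]_N) n :
  homogeneous_mx gr w t C -> homogeneous_mx gr w' w D ->
  (forall v, v *m C = 0 <-> rowspan D v) ->
  (\rank (MW w' w n D) + \rank (MW w t n C) = dimW hS w n)%N.
Proof.
move=> homC homD syz.
have -> : (MW w' w n D :=: kermx (MW w t n C))%MS.
  have kerP (v : 'rV_(dimW hS w n)) :
      (v <= MW w' w n D)%MS <-> (v <= kermx (MW w t n C))%MS.
    rewrite (sub_MW cdE Ecd _ homD) -syz sub_kermx -(EW_mulMW cdE Ecd _ homC).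
    by split=> [vC|/eqP ->]; [apply/eqP/(EW_inj cdE); rewrite EW0 | rewrite EW0].
  apply/eqmxP/andP; split; apply/rV_subP => v.
    by move/(kerP v).1.
  by move/(kerP v).2.
by rewrite mxrank_ker subnK // rank_leq_row.
Qed.

Lemma MW_pencil (T : finType) s N (w : 'cV[nat]_s) (t : 'cV[nat]_N) n
    (e : T -> 'M[A^c]_(s, N)) (x : T -> k) (D : 'M[A^c]_(s, N)) :
  (forall i j, D i j = \sum_r x r *: (e r i j : A) :> A) ->
  MW w t n D = pencil (fun r => MW w t n (e r)) x.
Proof.
move=> DE; apply/matrixP => p q; rewrite mxE DE /pencil summxE.
rewrite /block_of /lin1_mx mxE /= mulr_suml linear_sum summxE.
apply: eq_bigr => r _; by rewrite -scalerAl linearZ !mxE.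
Qed.

Section FinitelyManyHilbertFunctions.
Variable (b : nat).

Definition basis_index : finType := {j : 'I_b.+1 & 'I_(hS 0 j)}.
Definition basis_elt (z : basis_index) : A :=
  E 0 (tag z) (delta_mx 0 (tagged z)).

Definition basis_coef (x : A) (z : basis_index) : k :=
  cd 0 (tag z) x 0 (tagged z).

Lemma basis_eltP j x : (j <= b)%N -> gr j x ->
  x = \sum_z basis_coef x z *: basis_elt z.
Proof.
move=> le_jb gx.
transitivity (\sum_(i < b.+1)
    \sum_(l < hS 0 i) cd 0 i x 0 l *: E 0 i (delta_mx 0 l));
  last by rewrite sig_big_dep.
transitivity (\sum_(i < b.+1) E 0 i (cd 0 i x)); last first.
  apply: eq_bigr => i _; rewrite [in LHS](row_sum_delta (cd 0 i x)) linear_sum.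
  by apply: eq_bigr => l _; rewrite linearZ.
have lt_j : (j < b.+1)%N by [].
rewrite (bigD1 (Ordinal lt_j)) //= big1 => [|i ne].
  by rewrite addr0 Ecd /proj leq0n subn0 (hcomp_gr grA _ gx) eqxx.
rewrite Ecd /proj leq0n subn0 (hcomp_gr grA _ gx) ifN //.
by apply: contra ne => /eqP eq_ji; apply/eqP/val_inj.
Qed.

Definition elementary s N (r : 'I_s * 'I_N * basis_index) : 'M[A^c]_(s, N) :=
  \matrix_(i, j) if (i, j) == r.1 then (basis_elt r.2 : A^c) else 0.

(** Entries of degree at most b range over a finite-dimensional space, so D becomes a point of an
    affine space that does not depend on the degree n in which ranks are taken. *)
Lemma elementary_span s N (w : 'cV[nat]_s) (t : 'cV[nat]_N) (D : 'M[A^c]_(s, N)) :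
  homogeneous_mx gr w t D -> (forall i, (w i 0%R <= b)%N) ->
  exists x : 'I_s * 'I_N * basis_index -> k,
    forall i j, D i j = \sum_r x r *: (elementary r i j : A) :> A.
Proof.
move=> homD wb; exists (fun r => basis_coef (D r.1.1 r.1.2) r.2).
move=> i j.
transitivity (\sum_(r : 'I_s * 'I_N) \sum_z basis_coef (D r.1 r.2) z
    *: (elementary (r, z) i j : A)); last by rewrite pair_bigA.
rewrite (bigD1 (i, j)) //= [X in _ + X]big1 ?addr0 => [|r ne]; last first.
  apply: big1 => z _; rewrite mxE /= eq_sym (negbTE ne).
  by rewrite scaler0.
have := homD i j; rewrite /shift_grading; case: ifP => [le_tw gD|_ D0]; last first.
  by rewrite D0 big1 // => z _; rewrite /basis_coef linear0 mxE scale0r.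
rewrite {1}(basis_eltP (leq_trans (leq_subr _ _) (wb i)) gD).
by apply: eq_bigr => z _; rewrite mxE eqxx.
Qed.

Lemma finite_hilb_shape s u (w : 'cV[nat]_s) (w' : 'cV[nat]_u) :
  (forall i, (w i 0%R <= b)%N) -> (forall i, (w' i 0%R <= b)%N) ->
  finite_set [set h : nat -> nat | exists (C : 'M[A^c]_(s, 1)) (D : 'M[A^c]_(u, s)),
    [/\ homogeneous_mx gr w 0 C, homogeneous_mx gr w' w D,
        forall v, v *m C = 0 <-> rowspan D v &
        forall n, h n = \rank (MW w 0 n C)]].
Proof.
move=> wb w'b.
(* A point of T -> k records C and D together: Psi reads the first summand and Phi the second. G
   below only keeps the rank condition, in all degrees at once. *)
pose T : finType := ('I_s * 'I_1 * basis_index + 'I_u * 'I_s * basis_index)%type.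
pose Psi n (r : T) : 'M[k]_(dimW hS w n, dimW hS (0 : 'cV_1) n) :=
  if r is inl r1 then MW w 0 n (elementary r1) else 0.
pose Phi n (r : T) : 'M[k]_(dimW hS w' n, dimW hS w n) :=
  if r is inr r2 then MW w' w n (elementary r2) else 0.
pose G : set (T -> k) := [set x | forall n,
  (\rank (pencil (Phi n) x) + \rank (pencil (Psi n) x) = dimW hS w n)%N].
apply: sub_finite_set (finite_rank_functions (G := G) (Phi := Phi) (Psi := Psi)
  (c := dimW hS w) _) => [h [C [D [homC homD syz hE]]]|x n]; last exact.
have [x1 CE] := elementary_span homC wb.
have [x2 DE] := elementary_span homD w'b.
pose x (r : T) := match r with inl r1 => x1 r1 | inr r2 => x2 r2 end.
have PsiE n : pencil (Psi n) x = MW w 0 n C.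
  rewrite (MW_pencil _ _ _ CE) /pencil big_sumType /= [X in _ + X]big1 ?addr0 //.
  by move=> r _; rewrite scaler0.
have PhiE n : pencil (Phi n) x = MW w' w n D.
  rewrite (MW_pencil _ _ _ DE) /pencil big_sumType /= big1 ?add0r //.
  by move=> r _; rewrite scaler0.
by exists x => n; rewrite PsiE // PhiE; exact: rank_exact.
Qed.

End FinitelyManyHilbertFunctions.

Variables (F : set (set A)) (d : nat).
Hypothesis cohF : quasi_coherent_family gr F.
Hypothesis degF : family_of_degree gr F d.

Lemma finite_hilb :
  finite_set [set h | exists2 I, F I /\ ~ I 1 & h = hilb I].
Proof.
(* S bounds the number of generators and S * S that of relations; d + d bounds the degrees of the
   relations and, with room to spare, those of the generators. *)
pose S := low_rank E d [set: A].
pose shape := {s : 'I_S.+1 & {u : 'I_(S * S).+1 &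
  ({ffun 'I_s -> 'I_(d + d).+1} * {ffun 'I_u -> 'I_(d + d).+1})%type}}.
pose W n (f : {ffun 'I_n -> 'I_(d + d).+1}) : 'cV[nat]_n := \col_i (f i : nat).
pose H s u (w : 'cV[nat]_s) (w' : 'cV[nat]_u) : set (nat -> nat) :=
  [set h | exists (C : 'M[A^c]_(s, 1)) (D : 'M[A^c]_(u, s)),
    [/\ homogeneous_mx gr w 0 C, homogeneous_mx gr w' w D,
        forall v, v *m C = 0 <-> rowspan D v &
        forall n, h n = \rank (MW w 0 n C)]].
pose Hs (z : shape) :=
  H _ _ (W _ (tagged (tagged z)).1) (W _ (tagged (tagged z)).2).
apply: (sub_finite_set (B := \bigcup_(z in [set: shape]) Hs z)); last first.
  apply: bigcup_finite; first exact: finite_finset.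
  by move=> z _; apply: finite_hilb_shape => i; rewrite mxE -ltnS.
move=> h [I [FI nI1] ->].
have [s [w [C [[lqC homC spanC] wP le_s]]]] := flag_exists Ecd cohF degF FI nI1.
have [|u [w' [D [_ homD w'P le_u syz]]]] :=
  syzygies Ecd cohF degF (lo := 0) (hi := d) lqC homC.
  by move=> i; have := wP i; lia.
have {}le_s : (s < S.+1)%N.
  rewrite ltnS; apply: leq_trans le_s _.
  exact/low_rank_le/(family_right_ideal cohF).
have {}le_u : (u < (S * S).+1)%N.
  by rewrite ltnS; apply: leq_trans le_u _; rewrite leq_mul2r -ltnS le_s orbT.
have WE n (v : 'cV[nat]_n) : (forall i, (v i 0%R <= d + d)%N) ->
    W n [ffun i => inord (v i 0)] = v.
  by move=> vP; apply/colP => i; rewrite mxE ffunE inordK // ltnS.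
exists (existT _ (Ordinal le_s) (existT _ (Ordinal le_u)
   ([ffun i => inord (w i 0)], [ffun i => inord (w' i 0)]))) => //=.
rewrite /Hs /= !WE => [|i|i]; first last.
- by have := wP i; lia.
- by have := w'P i; lia.
exists C, D; split=> // n.
by rewrite /hilb spanC (piece_rank_rowspan cdE Ecd n homC).
Qed.

Lemma hilb_recursion I : F I -> ~ I 1 ->
  exists s (a : 'I_s -> nat) (J : 'I_s -> set A),
    [/\ forall i, (0 < a i)%N, forall i, F (J i) /\ ~ J i 1 &
        forall n, (hilb I n + \sum_i shift_fun (a i) (hilb (J i)) n =
                   \sum_i shift_fun (a i) (hilb setT) n)%N].
Proof.
move=> FI nI1.
have [s [w [C [[lqC homC spanC] wP _]]]] := flag_exists Ecd cohF degF FI nI1.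
have [J [JP rkC]] := rank_linear_quotients (family_right_ideal cohF) lqC.
exists s, (fun i => w i 0), J; split=> // [i|n]; first by case/andP: (wP i).
by rewrite -(rkC _ _ n homC) /hilb spanC (piece_rank_rowspan cdE Ecd n homC).
Qed.

Lemma hilbert_series_hilb I : right_ideal I -> hilbert_series gr I (hilb I).
Proof.
move=> idI n; have [U US] := represents_exists E 0 n (ideal_rows_submodule idI).
rewrite /hilb (piece_rank_eq US); pose B := row_base U.
pose e (c : 'rV[k]_(dimW hS (0 : 'cV_1) n)) : A := EW E c 0 0.
have eE c : EW E c = (e c : A^c)%:M by apply/rowP => j; rewrite !ord1 [RHS]mxE.
have eI c : (c <= U)%MS <-> I (e c) by rewrite US /ideal_rows.
have ge c : gr n (e c).
  rewrite /e -(projW_EW cdE Ecd) !mxE /= /proj leq0n subn0; exact: gr_hcomp.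
have elin a x y : e (a *: x + y) = a *: e x + e y.
  by rewrite /e EWD EWZ !mxE -[_ * _]/(_ * (a%:A : A)) mulr_algr.
have e0 : e 0 = 0 by rewrite /e EW0 mxE.
have einj x : e x = 0 -> x = 0.
  by move=> x0; apply: (EW_inj cdE); rewrite EW0 eE x0;
    apply/rowP => j; rewrite !mxE mul0rn.
exists (fun i => e (row i B)); split=> [i|z [Iz gz]].
  split; last exact: ge.
  by apply/eI; rewrite -(eq_row_base U) row_sub.
have sumE (c : 'rV_(\rank U)) : \sum_i c 0 i *: e (row i B) = e (c *m B).
  rewrite mulmx_sum_row; elim/big_rec2: _ => [|i y1 y2 _ ->]; first by rewrite e0.
  by rewrite elin.
have zE : e (cdW cd 0 n ((z : A^c)%:M)) = z.
  rewrite /e (EcdW Ecd) !mxE /= /proj leq0n subn0 mulr1n.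
  by rewrite (hcomp_gr grA _ gz) eqxx.
have : (cdW cd 0 n ((z : A^c)%:M) <= B)%MS.
  by rewrite eq_row_base; apply/eI; rewrite zE.
move=> /submxP[c cE]; exists c; split=> [|c']; rewrite /= sumE.
  by rewrite -cE zE subrr.
move=> /subr0_eq; rewrite -{1}zE cE => /eqP; rewrite -subr_eq0 => /eqP ee.
apply: (row_free_inj (row_base_free U)); apply/subr0_eq/einj.
by rewrite -scaleN1r addrC elin scaleN1r addrC.
Qed.

End HilbertFunctions.

(** * Rationality of power series by truncation *)

Definition trunc (n : nat) (h : nat -> nat) : {poly int} :=
  \poly_(i < n.+1) (h i)%:Z.

(** Power series can thus be replaced by polynomials, one coefficient of the identity to be proved
    at a time. *)
Lemma poly_mul_series_trunc p h n m : (n <= m)%N ->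
  poly_mul_series p h n = (p * trunc m h)`_n.
Proof.
move=> le_nm; rewrite /poly_mul_series coefM; apply: eq_bigr => i _.
by rewrite /trunc coef_poly ifT //; lia.
Qed.

Lemma coef_mul_low (n : nat) (p q : {poly int}) :
  (forall i, (i <= n)%N -> q`_i = 0) -> forall i, (i <= n)%N -> (p * q)`_i = 0.
Proof.
move=> q0 i le_in; rewrite coefM big1 // => j _.
by rewrite q0 ?mulr0 //; lia.
Qed.

Lemma coef_Xn_trunc t n h i : (i <= n)%N ->
  ('X^t * trunc n h)`_i = (shift_fun t h i)%:Z.
Proof.
move=> le_in; rewrite coefXnM /shift_fun; case: leqP => // le_ti.
by rewrite /trunc coef_poly ifT //; lia.
Qed.

(* The system reads (1 + N) h = p A with N divisible by z, so that det (1 + N)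
   has constant term 1; multiply by the adjugate. *)
Lemma linear_system_rational m (h : 'I_m -> nat -> nat) (hA : nat -> nat) :
  (forall a, exists l : seq (nat * 'I_m), (forall x, x \in l -> (0 < x.1)%N) /\
     forall n, (h a n + \sum_(x <- l) shift_fun x.1 (h x.2) n =
                \sum_(x <- l) shift_fun x.1 hA n)%N) ->
  forall a, exists p q : {poly int}, q != 0 /\
    forall n, poly_mul_series q (h a) n = poly_mul_series p hA n.
Proof.
move=> /choice[l lP] a.
pose N : 'M[{poly int}]_m := \matrix_(a, b) \sum_(x <- l a | x.2 == b) 'X^(x.1).
pose P : 'cV[{poly int}]_m := \col_a \sum_(x <- l a) 'X^(x.1).
exists ((\adj (1%:M + N) *m P) a 0), (\det (1%:M + N)); split.
  apply/eqP => det0; have : (\det (1%:M + N)).[0] = 1.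
    rewrite -[LHS]/(horner_eval 0 _) -det_map_mx.
    rewrite (_ : map_mx _ _ = 1%:M) ?det1 //; apply/matrixP => i j.
    rewrite !mxE rmorphD rmorph_nat rmorph_sum big_seq_cond big1 ?addr0 // => x.
    move=> /andP[xl _]; have := (lP i).1 x xl.
    by rewrite /= /horner_eval hornerXn expr0n; case: x.1.
  by rewrite det0 horner0 => /eqP.
move=> n; pose H : 'cV[{poly int}]_m := \col_b trunc n (h b).
(* With truncated series the system holds only up to degree n. The defect R has no terms of degree
   at most n, and this survives multiplication by the adjugate. *)
pose R := (1%:M + N) *m H - trunc n hA *: P.
have Rlow b i : (i <= n)%N -> (R b 0)`_i = 0.
  move=> le_in; rewrite /R mulmxDl mul1mx !mxE.
  have -> : \sum_j N b j * H j 0 = \sum_(x <- l b) 'X^(x.1) * trunc n (h x.2).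
    under eq_bigr => j _ do rewrite !mxE mulr_suml.
    rewrite (exchange_big_dep xpredT) //=; apply: eq_bigr => x _.
    by rewrite (big_pred1 x.2) // => j; rewrite eq_sym.
  rewrite mulr_sumr coefB coefD !coef_sum [(trunc n (h b))`_i]coef_poly ltnS le_in.
  under eq_bigr => x _ do rewrite coef_Xn_trunc //.
  under [X in _ - X]eq_bigr => x _ do rewrite mulrC coef_Xn_trunc //.
  rewrite -!(big_morph Posz PoszD (erefl (Posz 0))) -PoszD.
  by rewrite (lP b).2 subrr.
rewrite !(poly_mul_series_trunc _ _ (leqnn n)).
have -> : \det (1%:M + N) * trunc n (h a) = (\adj (1%:M + N) *m P) a 0 * trunc n hA
    + (\adj (1%:M + N) *m R) a 0.
  rewrite /R mulmxBr mulmxA mul_adj_mx mul_scalar_mx -scalemxAr !mxE.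
  by rewrite [X in _ = X + _]mulrC [RHS]addrC subrK.
rewrite coefD [X in _ + X](_ : _ = 0) ?addr0 // mxE coef_sum big1 // => b _.
exact: coef_mul_low (Rlow b) _ (leqnn n).
Qed.

Lemma finite_rational (P : set (nat -> nat)) (hA : nat -> nat) : finite_set P ->
  (forall h, P h -> exists s (a : 'I_s -> nat) (g : 'I_s -> nat -> nat),
     [/\ forall i, (0 < a i)%N, forall i, P (g i) &
       forall n, (h n + \sum_i shift_fun (a i) (g i) n =
                  \sum_i shift_fun (a i) hA n)%N]) ->
  forall h, P h -> exists p q : {poly int}, q != 0 /\
    forall n, poly_mul_series q h n = poly_mul_series p hA n.
Proof.
move=> /finite_seqP[s sP] recP h; rewrite sP => /= hs.
pose f (i : 'I_(size s)) := nth h s i.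
have fP g : P g -> exists i, f i = g.
  rewrite sP /= => gs; have lt_g : (index g s < size s)%N by rewrite index_mem.
  by exists (Ordinal lt_g); rewrite /f /= nth_index.
have [a <-] : exists i, f i = h by apply: fP; rewrite sP.
apply: linear_system_rational => {}a.
have [|r [t [g [t0 gP hE]]]] := recP (f a); first by rewrite sP /=; exact: mem_nth.
have /choice[b bP] i : exists j, f j = g i by exact: fP.
exists [seq (t i, b i) | i <- index_enum 'I_r].
split=> [_ /mapP[i _ ->]|n]; first exact: t0.
rewrite !big_map -hE; congr addn.
by apply: eq_bigr => i _; rewrite /= bP.
Qed.
Lemma coef_cancel (n : nat) (w T : {poly int}) : T`_0 != 0 ->
  (forall i, (i <= n)%N -> (w * T)`_i = 0) -> forall i, (i <= n)%N -> w`_i = 0.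
Proof.
move=> T0 wT i; elim/ltn_ind: i => i IH le_in.
have := wT i le_in; rewrite coefM big_ord_recr /= subnn big1 => [|j _].
  by rewrite add0r => /eqP; rewrite mulf_eq0 (negbTE T0) orbF => /eqP.
by rewrite IH ?mul0r //; have := ltn_ord j; lia.
Qed.

(** The Euler formula reads h(z) = z^e hA(z) b(-z). With q h = p hA, cancelling hA, whose constant
    term is nonzero, gives q z^e b(-z) = p; it remains to replace z by -z. *)
Lemma rational_series_of_euler (h hA b : nat -> nat) (e : nat) (p q : {poly int}) :
  hA 0%N != 0%N -> q != 0 ->
  (forall n, poly_mul_series q h n = poly_mul_series p hA n) ->
  (forall n m, (n < m)%N ->
     (h n)%:Z = \sum_(i < m) (-1) ^+ i * (b i)%:Z * (shift_fun (e + i) hA n)%:Z) ->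
  rational_series b.
Proof.
move=> hA0 q0 qh euler.
pose Q := q * 'X^e.
pose beta n : {poly int} := \poly_(i < n.+1) ((-1) ^+ i * (b i)%:Z).
have Qbeta n : (Q * beta n)`_n = p`_n.
  apply/eqP; rewrite -subr_eq0 -coefB; apply/eqP.
  apply: (coef_cancel (n := n) (T := trunc n hA)) (leqnn n).
    by rewrite /trunc coef_poly /= eqz_nat.
  move=> i le_in; rewrite mulrBl coefB.
  rewrite -(poly_mul_series_trunc p hA le_in) -qh (poly_mul_series_trunc q h le_in).
  rewrite /Q -!mulrA -coefB -mulrBr; apply: (coef_mul_low (n := n)) => // j le_jn.
  rewrite coefB /trunc [X in _ - X]coef_poly ltnS le_jn (euler j n.+1) //.
  apply/eqP; rewrite subr_eq0; apply/eqP.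
  rewrite /beta poly_def mulrA mulr_sumr mulr_suml coef_sum.
  apply: eq_bigr => l _; rewrite -scalerAr -exprD -scalerAl coefZ.
  by rewrite (coef_Xn_trunc _ _ le_jn).
(* These are p(-z) and Q(-z). *)
pose p' : {poly int} := \poly_(i < size p) ((-1) ^+ i * p`_i).
pose q' : {poly int} := \poly_(i < size Q) ((-1) ^+ i * Q`_i).
have altE (f f' : {poly int}) : f' = \poly_(i < size f) ((-1) ^+ i * f`_i) ->
    forall i, f'`_i = (-1) ^+ i * f`_i.
  move=> -> i; rewrite coef_poly; case: ltnP => // le_i.
  by rewrite [f`_i]nth_default ?mulr0.
exists p', q'; split.
  apply/eqP => q'0; have : Q != 0 by rewrite mulf_neq0 // monic_neq0 ?monicXn.
  rewrite -lead_coef_eq0 lead_coefE => /negP; apply; apply/eqP.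
  have := altE Q q' erefl (size Q).-1; rewrite q'0 coef0 => /esym/eqP.
  by rewrite mulf_eq0 signr_eq0 => /eqP.
move=> n; rewrite (altE p p' erefl) -Qbeta coefM mulr_sumr.
apply: eq_bigr => i _; rewrite (altE Q q' erefl) coef_poly ifT; last by lia.
rewrite -[in (-1) ^+ n](subnKC (_ : i <= n)%N) ?exprD; last by rewrite -ltnS.
set sg := (-1) ^+ (n - i); have sgK : sg * sg = 1 by rewrite -expr2 sqrr_sign.
transitivity ((-1) ^+ i * Q`_i * (b (n - i)%N)%:Z * (sg * sg)); last by ring.
by rewrite sgK mulr1.
Qed.
(** * Linear resolutions *)

Section MinimalResolution.
Variables (k : fieldType) (A : algType k) (gr : nat -> set A).
Hypothesis grA : connected_grading gr.
Local Notation hcomp := (hcomp grA).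

Lemma hcomp0M x y : hcomp 0 (x * y) = hcomp 0 x * hcomp 0 y.
Proof.
have [n xE] := sum_hcomp grA x; rewrite [in LHS](xE n.+1) // mulr_suml linear_sum.
rewrite big_ord_recl big1 => [|i _] /=.
  by rewrite addr0 (hcomp_mull grA _ _ (gr_hcomp grA 0 x)) subnn.
by rewrite (hcomp_mull grA _ _ (gr_hcomp grA _ x)).
Qed.

Lemma scalar_inj (c d : k) : c%:A = d%:A :> A -> c = d.
Proof.
move=> /eqP; rewrite -subr_eq0 -scalerBl scaler_eq0 oner_eq0 orbF subr_eq0.
by move/eqP.
Qed.

Lemma free_module_rV n : free_module (A := A) 'rV[A^c]_n.
Proof.
exists (range (fun i : 'I_n => delta_mx 0 i)); split=> [x|m b a b_inj bP sum0 i].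
  exists n, (fun i => delta_mx 0 i), (fun i => x 0 i); split=> [i|].
    by exists i.
  exact: row_sum_delta.
have /choice[j jP] l : exists j, delta_mx 0 j = b l.
  by have [j _ <-] := bP l; exists j.
have := congr1 (fun v : 'rV[A^c]_n => v 0 (j i)) sum0; rewrite mxE summxE.
rewrite (bigD1 i) //= [X in _ + X]big1 => [|l ne].
  by rewrite -jP !mxE !eqxx mulr1 addr0.
rewrite -jP !mxE eqxx /=; case: eqP => [eqj|_]; last by rewrite mulr0.
by case/eqP: ne; apply: b_inj; rewrite -!jP eqj.
Qed.

Lemma mul_augmentation_rV n (x : 'rV[A^c]_n) :
  mul_augmentation gr setT x <-> forall j, hcomp 0 (x 0 j : A) = 0.
Proof.
split=> [[m [s [a [sa ->]]]] j|x0].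
  rewrite summxE linear_sum big1 // => i _; rewrite mxE.
  rewrite -[_ * _]/((s i 0 j : A) * a i) /= hcomp0M.
  by have [_ /(augmentation_idealE grA) ->] := sa i; rewrite mulr0.
exists n, (fun i => delta_mx 0 i), (fun i => x 0 i); split=> [i|].
  by split=> //; apply/(augmentation_idealE grA).
exact: row_sum_delta.
Qed.

Lemma restrict_scalars_sum (M : lmodType A^c) n (c : 'I_n -> k) (x : 'I_n -> M) :
  \sum_i c i *: (x i : restrict_scalars M) = \sum_i ((c i)%:A : A^c) *: x i :> M.
Proof.
by apply: (big_ind2 (fun (u : restrict_scalars M) (v : M) => u = v :> M)) =>
  // u u' v v' -> ->.
Qed.

Variables (I : set A) (b : nat -> nat).
Variables (D0 : 'M[A^c]_(b 0%N, 1)) (D : forall i, 'M[A^c]_(b i.+1, b i)).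
Hypothesis spanI : ideal_rows I = rowspan D0.
Hypothesis exact0 : forall v, v *m D0 = 0 <-> rowspan (D 0) v.
Hypothesis exactS : forall i v, v *m D i = 0 <-> rowspan (D i.+1) v.
Hypothesis minimal : forall i j l, hcomp 0 (D i j l : A) = 0.

(** The entries of the differentials lie in A_+, so these vanish after tensoring with k: every
    element is a cycle, the boundaries reduce to P A_+, and the standard basis vectors give a basis
    of Tor. *)
Lemma minimal_resolution_Poincare : Poincare_series gr I b.
Proof.
move=> i0.
pose P i : lmodType A^c := 'rV[A^c]_(b i).
pose eps0 (v : P 0%N) : A^c^o := (v *m D0) 0 0.
have eps_lin : linear eps0.
  by move=> a u v; rewrite /eps0 mulmxDl -scalemxAl !mxE.
pose L := GRing.isLinear.Build A^c (P 0%N) A^c^o *:%R eps0 eps_lin.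
pose eps : {linear P 0%N -> A^c^o} := HB.pack eps0 L.
pose del i : {linear P i.+1 -> P i} := mulmxr (D i).
have eps_ker v : eps v = 0 <-> v *m D0 = 0.
  rewrite /eps /= /eps0; split=> [v0|->]; last by rewrite mxE.
  by apply/rowP => j; rewrite ord1 v0 mxE.
have minimalM i (v : 'rV_(b i.+1)) j : hcomp 0 ((v *m D i) 0 j : A) = 0.
  rewrite mulmx_conv linear_sum big1 // => l _.
  by rewrite /= hcomp0M minimal mul0r.
exists P, eps, del; split.
  split.
  - by move=> i; exact: free_module_rV.
  - apply/seteqP; split=> x.
      move=> [v _ <-]; have : rowspan D0 (v *m D0) by exists v.
      by rewrite -spanI.
    move=> Ix; have : ideal_rows I (x%:M : 'rV[A^c]_1).
      by rewrite /ideal_rows /= mxE.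
    rewrite spanI => -[v vE]; exists v => //.
    by rewrite /eps /= /eps0 -vE mxE.
  - apply/seteqP; split=> v.
      by move=> /eps_ker/exact0[c ->]; exists c.
    by move=> [c _ <-]; apply/eps_ker/exact0; exists c.
  - move=> i; apply/seteqP; split=> v.
      by move=> /exactS[c ->]; exists c.
    by move=> [c _ <-]; apply/exactS; exists c.
exists (fun i => delta_mx 0 i : P i0); split=> [i|z _].
  case: i0 i => [//|i0] i /=.
  by apply/mul_augmentation_rV => j; exact: minimalM.
have boundE (v : P i0) : tensor_boundaries gr del v <->
    forall j, hcomp 0 (v 0 j : A) = 0.
  split=> [[y /mul_augmentation_rV vy] j|v0].
    have := vy j; rewrite !mxE linearB /=.
    have := minimalM i0 y j; rewrite mxE => ->.
    by rewrite subr0.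
  by exists 0; rewrite linear0 subr0; apply/mul_augmentation_rV.
have /choice[c cP] j : exists c, hcomp 0 ((z : P i0) 0 j : A) = c%:A.
  by apply: (gr0_scalar grA); exact: gr_hcomp.
have sumE (d : 'rV[k]_(b i0)) j :
    ((\sum_i d 0 i *: (delta_mx 0 i : restrict_scalars (P i0)) :
       restrict_scalars (P i0)) : P i0) 0 j = ((d 0 j)%:A : A).
  rewrite (restrict_scalars_sum (M := P i0)).
  have -> : \sum_i ((d 0 i)%:A : A^c) *: (delta_mx 0 i : P i0) =
     \row_i ((d 0 i)%:A : A^c).
    by rewrite [RHS]row_sum_delta; apply: eq_bigr => i _; rewrite mxE.
  by rewrite mxE.
have coefE (d : 'rV[k]_(b i0)) : tensor_boundaries gr del
    (z - \sum_i d 0 i *: (delta_mx 0 i : restrict_scalars (P i0)) : P i0) <->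
    forall j, c j = d 0 j.
  have entryE j :
      ((z - \sum_i d 0 i *: (delta_mx 0 i : restrict_scalars (P i0)) : P i0)
        0 j : A) = (z : P i0) 0 j - (d 0 j)%:A.
    by rewrite -sumE !mxE.
  rewrite boundE; split=> cd j.
    have := cd j.
    rewrite entryE linearB /= cP (hcomp_gr grA _ (gr_scalar grA _)) eqxx.
    by move=> /subr0_eq/scalar_inj.
  by rewrite entryE linearB /= cP (hcomp_gr grA _ (gr_scalar grA _)) eqxx cd subrr.
exists (\row_j c j); split=> [|d /coefE cd].
  by apply/coefE => j; rewrite mxE.
by apply/rowP => j; rewrite mxE cd.
Qed.

End MinimalResolution.

(** * Koszul families: linearity of the resolution and Euler characteristic *)

Section Koszul.
Variables (k : fieldType) (A : algType k) (gr : nat -> set A).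
Hypothesis grA : connected_grading gr.
Variables (hS : nat -> nat -> nat).
Variables (E : forall t n, {linear 'rV[k]_(hS t n) -> A}).
Variables (cd : forall t n, {linear A -> 'rV[k]_(hS t n)}).
Hypothesis cdE : forall t n c, cd t n (E t n c) = c.
Hypothesis Ecd : forall t n x, E t n (cd t n x) = proj grA t n x.
Variable F : set (set A).
Hypothesis cohF : quasi_coherent_family gr F.
Hypothesis degF : family_of_degree gr F 1.

(* The rows of stage_mx generate a syzygy module of the linear resolution. *)
Record stage := Stage {
  stage_rank : nat;
  stage_size : nat;
  stage_mx : 'M[A^c]_(stage_size, stage_rank);
  stage_wt : 'cV[nat]_stage_rank;
  stage_deg : nat;
  stage_lq : linear_quotients F stage_mx;
  stage_hom : homogeneous_mx gr (const_mx stage_deg) stage_wt stage_mx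
}.

(** With d = 1 and all rows in one degree e, the bounds e < w' <= e + 1 of [syzygies] leave a single
    degree for the relations. *)
Lemma next_syzygies (x : stage) : exists u (D : 'M[A^c]_(u, stage_size x)),
  [/\ linear_quotients F D,
      homogeneous_mx gr (const_mx (stage_deg x).+1) (const_mx (stage_deg x)) D &
      forall v, v *m stage_mx x = 0 <-> rowspan D v].
Proof.
have [|u [w [D [lqD homD wP _ syz]]]] := syzygies Ecd cohF degF
  (lo := stage_deg x) (hi := stage_deg x) (stage_lq x) (stage_hom (s := x)).
  by move=> i; rewrite mxE leqnn.
exists u, D; split=> //; rewrite (_ : const_mx _ = w) //.
by apply/colP => i; rewrite mxE; have := wP i; lia.
Qed.

Definition next_stage (x : stage) : stage :=
  let: D := svalP (cid (next_syzygies x)) in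
  let: P := svalP (cid D) in
  Stage (let: And3 lqD _ _ := P in lqD) (let: And3 _ homD _ := P in homD).

Lemma next_stageP (x : stage) (v : 'rV_(stage_size x)) :
  v *m stage_mx x = 0 <-> rowspan (stage_mx (next_stage x)) v.
Proof.
rewrite /next_stage /=; by case: (svalP (cid (svalP (cid (next_syzygies x))))).
Qed.

(** For proper I the bounds 0 < w <= 1 force e = 1. For I = A the generator 1 of degree 0 is used;
    its colon ideal is 0, a proper member of F. *)
Lemma initial_stage I : F I -> exists e s (C : 'M[A^c]_(s, 1)),
  [/\ linear_quotients F C, homogeneous_mx gr (const_mx e) 0 C &
      ideal_rows I = rowspan C].
Proof.
move=> FI; have [I1|nI1] := pselect (I 1).
  have colon0 : colon (1%:M : 'rV[A^c]_1) (0 : 'M[A^c]_(0, 1)) = [set 0].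
    apply/seteqP; split=> a /=.
      move=> [c]; rewrite mulmx0 => /(congr1 (fun v : 'rV[A^c]_1 => v 0 0)).
      by rewrite !mxE mulr1.
    by move=> ->; exists 0; rewrite mulmx0 scale0r.
  exists 0%N, (1 + 0)%N, (col_mx 1%:M 0); split.
  - apply/linear_quotients_col; rewrite colon0; split=> //.
      exact: family_zero cohF.
    by move=> /eqP; rewrite oner_eq0.
  - move=> i j; rewrite !mxE /shift_grading /= subnn.
    by case: split_ordP => [i' _|[]//]; rewrite !ord1 mxE; exact: gr_one.
  - have -> := right_ideal_one (family_right_ideal cohF FI) I1.
    apply/seteqP; split=> v // _; exists (row_mx v 0).
    by rewrite mul_row_col mulmx1 mul0mx addr0.
have [s [w [C [[lqC homC spanC] wP _]]]] := flag_exists Ecd cohF degF FI nI1.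
exists 1%N, s, C; split=> //; rewrite (_ : const_mx _ = w) //.
by apply/colP => i; rewrite mxE; have := wP i; lia.
Qed.

Lemma hilb_setT0 : hilb E setT 0 != 0%N.
Proof.
apply/eqP => h0; have hS0 : hS 0 0 = 0%N by rewrite (hS_hilb cdE Ecd).
have := Ecd 0 0 1; rewrite /proj /= (hcomp_gr grA _ (gr_one grA)) eqxx.
have -> : cd 0 0 1 = 0 by apply/rowP => i; have := ltn_ord i; rewrite {2}hS0.
by rewrite linear0 => /esym/eqP; rewrite oner_eq0.
Qed.

Lemma Koszul_resolution I : F I -> exists (b : nat -> nat) (e : nat),
  Poincare_series gr I b /\ forall n m, (n < m)%N -> (hilb E I n)%:Z =
    \sum_(i < m) (-1) ^+ i * (b i)%:Z * (shift_fun (e + i) (hilb E setT) n)%:Z.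
Proof.
move=> FI; have [e [s [C [lqC homC spanC]]]] := initial_stage FI.
pose st i := iter i next_stage (Stage lqC homC).
pose b i := stage_size (st i).
have degE i : stage_deg (st i) = (e + i)%N.
  by elim: i => [|i IH]; rewrite ?addn0 // addnS -IH.
exists b, e; split.
  (* This typechecks because the rank of a next stage is, by conversion, the size of the previous
     one. *)
  pose D i : 'M[A^c]_(b i.+1, b i) := stage_mx (st i.+1).
  apply: (@minimal_resolution_Poincare _ _ _ grA I b C D) => [//|v|i v|i j l].
  - exact: (next_stageP (x := st 0%N)).
  - exact: (next_stageP (x := st i.+1)).
  have := stage_hom (s := st i.+1) j l.
  rewrite /D !mxE /shift_grading leqnSn subSnn => gD.
  by rewrite (hcomp_gr grA _ gD).
pose H i n := \rank (MW E cd (const_mx (stage_deg (st i))) (stage_wt (st i)) n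
                       (stage_mx (st i))).
have H0 n : hilb E I n = H 0%N n.
  by rewrite /hilb spanC (piece_rank_rowspan cdE Ecd n homC).
have dimE i n : dimW hS (const_mx (e + i)%N : 'cV_(b i)) n =
    (b i * shift_fun (e + i) (hilb E setT) n)%N.
  rewrite /dimW; under eq_bigr => j _ do rewrite mxE (hS_hilb cdE Ecd).
  by rewrite sum_nat_const card_ord.
have HS i n : (H i.+1 n + H i n = b i * shift_fun (e + i) (hilb E setT) n)%N.
  rewrite -dimE -degE; apply: (rank_exact cdE Ecd) (next_stageP (x := st i)).
    exact: stage_hom.
  exact: (stage_hom (s := st i.+1)).
(* The i-th free module is generated in degree e + i, so in each degree n only finitely many terms
   of the resolution contribute. *)
have Hvanish i n : (n < i)%N -> H i n = 0%N.
  move=> lt_ni; apply/eqP; rewrite -leqn0.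
  apply: leq_trans (rank_leq_row _) _; rewrite degE dimE /shift_fun ifF ?muln0 //.
  by lia.
(* The rank identities [HS] telescope with alternating signs; the last term is the contribution of
   the m-th syzygies. *)
have partial n m : (hilb E I n)%:Z =
    \sum_(i < m) (-1) ^+ i * (b i)%:Z * (shift_fun (e + i) (hilb E setT) n)%:Z
    + (-1) ^+ m * (H m n)%:Z.
  elim: m => [|m IH]; first by rewrite big_ord0 add0r expr0 mul1r H0.
  rewrite IH big_ord_recr /= -addrA -[_ * _ * _]mulrA -PoszM -HS PoszD exprS.
  by congr (_ + _); ring.
by move=> n m lt_nm; rewrite (partial n m) Hvanish // mulr0 addr0.
Qed.

End Koszul.

Theorem corollary1p10 (k : fieldType) (A : algType k) (gr : nat -> set A)
    (grA : connected_grading gr) (fpA : finitely_presented A)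
    (F : set (set A)) (d : nat) (cohF : quasi_coherent_family gr F)
    (degF : family_of_degree gr F d) :
  (forall I, F I ->
     exists hA hI : nat -> nat,
       [/\ hilbert_series gr setT hA, hilbert_series gr I hI &
           exists p q : {poly int}, q != 0 /\
             forall n, poly_mul_series q hI n = poly_mul_series p hA n]) /\
  (d = 1%N -> forall I, F I ->
     exists b : nat -> nat, Poincare_series gr I b /\ rational_series b).
Proof.
have [hS [E [cd [cdE Ecd]]]] := graded_coordinates grA fpA.
have rational I : F I -> exists p q : {poly int}, q != 0 /\
    forall n, poly_mul_series q (hilb E I) n = poly_mul_series p (hilb E setT) n.
  (* Only proper ideals enter the finite linear system; the ideal A itself is settled by p = q =
     1. *)
  move=> FI; have [I1|nI1] := pselect (I 1).
    exists 1, 1; split; first exact: oner_neq0.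
    by have -> := right_ideal_one (family_right_ideal cohF FI) I1.
  have fin := finite_hilb cdE Ecd cohF degF.
  apply: (finite_rational fin) => [h [J [FJ nJ1] ->]|]; last by exists I.
  have [s [a [G [a0 GP rec]]]] := hilb_recursion cdE Ecd cohF degF FJ nJ1.
  exists s, a, (fun i => hilb E (G i)); split=> // i.
  by exists (G i).
split=> [I FI|d1 I FI].
  exists (hilb E setT), (hilb E I); split; last exact: rational.
    exact: (hilbert_series_hilb cdE Ecd) (right_idealT A).
  exact: (hilbert_series_hilb cdE Ecd) (family_right_ideal cohF FI).
rewrite d1 in degF; have [p [q [q0 qhI]]] := rational I FI.
have [b [e [bI euler]]] := Koszul_resolution cdE Ecd cohF degF FI.
exists b; split=> //; apply: rational_series_of_euler q0 qhI euler.
exact: hilb_setT0 cdE Ecd.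
Qed.
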